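(* Let $(K,v)$ be a valued field of characteristic $0$ with residue field of characteristic $0$, regarded as an $\mathcal{L}_{Mac}$-structure in the natural way, such that $\mathrm{Th}(K)$ admits quantifier elimination in $\mathcal{L}_{Mac}$ and $(K,v)$ is of prohenselian degree $2$. Then there is a valued field $(L,w)$ such that $w$ is of rank $1$ and $(L,w)\equiv(K,v)$ as $\mathcal{L}_{Mac}$-structures.
   Context: Valuation rings are proper subrings. $\mathcal{L}_{Mac}=\{+,-,\cdot,0,1\}\cup\{\mathcal{O}\}\cup\{P_n:n>1\}$ with $\mathcal{O}$ interpreted as the valuation ring and $P_n$ as the set of nonzero $n$th powers. A valuation is of rank $1$ if its value group is nontrivial and has no convex subgroups other than $\{0\}$ and itself. For $(L,w)$ with valuation ring $\mathcal{O}$, maximal ideal $\mathcal{M}$, and $r,t\in\mathcal{O}$: $r\asymp t$ if there is a natural number $n\ge1$ with $w(r^n)\le w(t)\le w(r^{n+1})$ or $w(t^n)\le w(r)\le w(t^{n+1})$; $r\ll t$ (also $t\gg r$) if they are not comparable and $w(r)<w(t)$. $\mathbb{Q}(A)$ is the subfield generated by $A$; $F^L$ is the algebraic closure in $L$ of a subfield $F$. A valuation ring $R$ of a field $F$ admits a henselian coarsening if some henselian valuation ring $R'\subsetneq F$ contains $R$. $(L,w)$ is of prohenselian degree $n$ if for each $1\le m\le n$ and all $t_1,\dots,t_m\in\mathcal{M}$ with $t_m\gg\dots\gg t_1$, the valuation ring $\mathbb{Q}(t_1,\dots,t_m)^L\cap\mathcal{O}$ of $\mathbb{Q}(t_1,\dots,t_m)^L$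 admits a henselian coarsening. *)

(* Defs.v *)
From HB Require Import structures.
From mathcomp Require Import all_boot all_order all_algebra.
From mathcomp Require Import boolp classical_sets.

Set Implicit Arguments.
Unset Strict Implicit.
Unset Printing Implicit Defensive.

Import Order.TTheory GRing.Theory Num.Theory.
Local Open Scope ring_scope.
Local Open Scope classical_set_scope.
Local Open Scope quotient_scope.

(* [porderZmodType] does not relate the order to the addition. *)
Record ordered_group := OrderedGroup {
  og_sort :> porderZmodType;
  og_total : total (<=%R : rel og_sort);
  og_add : forall x y z : og_sort, x <= y -> z + x <= z + y
}.

Definition convex_subgroup (G : ordered_group) (H : set G) : Prop :=
  zmod_closed [in H] /\
  (forall x y z : G, x \in H -> z \in H -> x <= y -> y <= z -> y \in H).

Definition rank_one_group (G : ordered_group) : Prop :=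
  (exists g : G, g != 0) /\
  (forall H : set G, convex_subgroup H -> H = [set 0] \/ H = [set: G]).

(* [option G] is G with the value infinity, [None], added on top. *)
Definition vle (G : ordered_group) (a b : option G) : bool :=
  match a, b with
  | _, None => true
  | None, Some _ => false
  | Some g, Some h => g <= h
  end.

Definition vlt (G : ordered_group) (a b : option G) : bool := ~~ vle b a.

Definition vmin (G : ordered_group) (a b : option G) : option G :=
  if vle a b then a else b.

Definition vadd (G : ordered_group) (a b : option G) : option G :=
  if a is Some g then if b is Some h then Some (g + h) else None else None.

(* [vf_nontrivial] says that the valuation ring is a proper subring. *)
Record valued_field := ValuedField {
  vf_field :> fieldType;
  value_group : ordered_group;
  vval : vf_field -> option value_group;
  vval_infty : forall x, vval x = None <-> x = 0;
  vvalM : forall x y, vval (x * y) = vadd (vval x) (vval y);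
  vvalD : forall x y, vle (vmin (vval x) (vval y)) (vval (x + y));
  vval_surj : forall g, exists x, vval x = Some g;
  vf_nontrivial : exists x, vlt (vval x) (Some 0)
}.

Arguments vval {v} _.

Definition rank_one (L : valued_field) : Prop := rank_one_group (value_group L).

Definition valring (L : valued_field) : {pred L} :=
  [pred x : L | vle (Some 0) (vval x)].

Definition valideal (L : valued_field) : {pred L} :=
  [pred x : L | vlt (Some 0) (vval x)].

Arguments valring : clear implicits.
Arguments valideal : clear implicits.

Section ValuationTheory.
Variable L : valued_field.
Let G := value_group L.
Local Notation v := (@vval L).

Let vvalD_or (x y : L) :
  vle (v x) (v (x + y)) \/ vle (v y) (v (x + y)).
Proof. by have := vvalD x y; rewrite /vmin; case: ifP => _; [left | right]. Qed.

Let vle_trans (a b c : option G) : vle a b -> vle b c -> vle a c.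
Proof. by case: a b c => [a|] [b|] [c|] //=; apply: le_trans. Qed.

Let vle_total (a b : option G) : vle a b || vle b a.
Proof. by case: a b => [a|] [b|] //=; apply: og_total. Qed.

Let vltW (a b : option G) : vlt a b -> vle a b.
Proof. by rewrite /vlt; case/orP: (vle_total a b) => ->. Qed.

Let vlt_le_trans (a b c : option G) : vlt a b -> vle b c -> vlt a c.
Proof.
by move=> ab bc; apply/negP => ca; move: ab; rewrite /vlt (vle_trans bc ca).
Qed.

Let og_add2 (a b c d : G) : a <= b -> c <= d -> a + c <= b + d.
Proof.
move=> ab cd; apply: (le_trans (og_add a cd)).
by rewrite (addrC a) (addrC b); apply: og_add.
Qed.

Let v0 : v 0 = None. Proof. by apply/vval_infty. Qed.

Let v1 : v 1 = Some 0.
Proof.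
case E: (v 1) => [g|]; last by move/vval_infty/eqP: E; rewrite oner_eq0.
have := @vvalM L 1 1; rewrite mulr1 E /= => -[] /esym/eqP.
by rewrite -subr_eq0 addrK => /eqP ->.
Qed.

Let og_sgn (g : G) : g + g = 0 -> g = 0.
Proof.
move=> gg; have /orP[g0|g0] := og_total 0 g; apply: le_anti; apply/andP;
  have := og_add g g0; rewrite addr0 gg; by split.
Qed.

Let vN x : v (- x) = v x.
Proof.
have vN1 : v (-1) = Some 0.
  have := @vvalM L (-1) (-1); rewrite mulrNN mulr1 v1.
  by case: (v (-1)) => //= g [] /esym/og_sgn ->.
by rewrite -mulN1r vvalM vN1; case: (v x) => //= g; rewrite add0r.
Qed.

Let vV x g : v x = Some g -> v x^-1 = Some (- g).
Proof.
move=> vx; have x0 : x != 0 by apply/eqP => x0; move: vx; rewrite x0 v0.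
have := @vvalM L x x^-1; rewrite divff // v1 vx.
by case: (v _) => //= h [] /esym/eqP; rewrite addrC addr_eq0 => /eqP ->.
Qed.

Lemma valring_subring_closed : subring_closed (valring L).
Proof.
split; first by rewrite inE v1 /=.
- move=> x y; rewrite !inE => xO yO.
  have [|] := vvalD_or x (- y); rewrite ?vN; exact: vle_trans.
- move=> x y; rewrite !inE vvalM; case: (v x) (v y) => [a|] [b|] //= a0 b0.
  by rewrite -[0]addr0 og_add2.
Qed.

Lemma valideal_idealr (x y z : L) : x \in valring L ->
  y \in valideal L -> z \in valideal L -> x * y + z \in valideal L.
Proof.
rewrite !inE => x0 y0 z0.
have xy0 : vlt (Some 0) (v (x * y)).
  apply: (vlt_le_trans y0); rewrite vvalM.
  case: (v x) (v y) x0 => [a|] [b|] //= a0.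
  by rewrite -[leLHS]add0r og_add2.
by have [|] := vvalD_or (x * y) z; apply: vlt_le_trans.
Qed.

Lemma valideal0 : 0 \in valideal L. Proof. by rewrite inE v0. Qed.

Lemma valideal1 : 1 \notin valideal L. Proof. by rewrite inE v1 /vlt /= lexx. Qed.

Lemma valideal_valring x : x \in valideal L -> x \in valring L.
Proof. by rewrite !inE; exact: vltW. Qed.

Lemma valring_unit x : x \in valring L -> x \notin valideal L ->
  x != 0 /\ x^-1 \in valring L.
Proof.
rewrite !inE /vlt negbK => _ x0; case E: (v x) x0 => [g|] //= g0.
split; first by apply/eqP => x0; move: E; rewrite x0 v0.
by rewrite (vV E) /=; have := og_add (- g) g0; rewrite addNr addr0.
Qed.

Lemma valideal_inv x : x \in valideal L -> x^-1 \in valring L -> x = 0.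
Proof.
rewrite !inE; case E: (v x) => [g|]; last by move/vval_infty: E.
rewrite (vV E) /vlt /= => /negP g0 Vg0; case: g0.
by have := og_add g Vg0; rewrite addr0 subrr.
Qed.

End ValuationTheory.

HB.instance Definition _ (L : valued_field) :=
  GRing.isSubringClosed.Build L (valring L) (valring_subring_closed L).

Record valring_type (L : valued_field) :=
  ValringType { valring_val :> L; _ : valring_val \in valring L }.

HB.instance Definition _ (L : valued_field) := [isSub for @valring_val L].
HB.instance Definition _ (L : valued_field) := [Choice of valring_type L by <:].
HB.instance Definition _ (L : valued_field) :=
  [SubChoice_isSubComNzRing of valring_type L by <:].

Definition valring_ideal (L : valued_field) : {pred valring_type L} :=
  [pred x : valring_type L | val x \in valideal L].

Lemma valring_ideal_idealr (L : valued_field) : idealr_closed (@valring_ideal L).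
Proof.
split; first exact: valideal0.
  exact: valideal1.
by move=> a x y; rewrite !inE => xM yM; apply: valideal_idealr => //; exact: valP.
Qed.

HB.instance Definition _ (L : valued_field) :=
  isIdealr.Build (valring_type L) (@valring_ideal L) (@valring_ideal_idealr L).

Definition residue_field (L : valued_field) : Type :=
  {ideal_quot (@valring_ideal L)}.

HB.instance Definition _ (L : valued_field) :=
  GRing.ComNzRing.on (residue_field L).

Section ResidueField.
Variable L : valued_field.

Definition residue_inv (q : residue_field L) : residue_field L :=
  \pi_{ideal_quot (@valring_ideal L)}
    (insubd (0 : valring_type L) (val (repr q))^-1).

Lemma residue_mulVf (q : residue_field L) : q != 0 -> residue_inv q * q = 1.
Proof.
rewrite /residue_inv -{1 3}(reprK q); set x := repr q => q0.
have xM : val x \notin valideal L.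
  apply: contra q0 => xM; rewrite -[X in _ == X](rmorph0 \pi_{ideal_quot _}).
  by rewrite -Quotient.idealrBE subr0.
have [x0 Vx] := valring_unit (valP x) xM.
rewrite -rmorphM -[RHS](rmorph1 \pi_{ideal_quot _}); congr (\pi _).
apply: val_inj; change (val (insubd (0 : valring_type L) (val x)^-1) * val x = 1).
by rewrite insubdK // mulVf.
Qed.

Lemma residue_inv0 : residue_inv 0 = 0.
Proof.
rewrite /residue_inv; set x := repr _.
have xM : val x \in valideal L.
  have : (\pi x == 0 :> residue_field L) by rewrite reprK.
  by rewrite -[X in _ == X](rmorph0 \pi_{ideal_quot _}) -Quotient.idealrBE subr0.
rewrite -[RHS](rmorph0 \pi_{ideal_quot _}); congr (\pi _).
apply: val_inj; rewrite val_insubd; case: ifP => // Vx.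
by rewrite (valideal_inv xM Vx) invr0.
Qed.

HB.instance Definition _ := GRing.ComNzRing_isField.Build (residue_field L)
  residue_mulVf residue_inv0.

End ResidueField.

Definition subfield (L : fieldType) (F : set L) : Prop :=
  divring_closed [in F].

Definition generated_subfield (L : fieldType) (A : set L) : set L :=
  smallest (@subfield L) A.

Definition rel_alg_closure (L : fieldType) (F : set L) : set L :=
  [set x | exists2 p : {poly L},
             p != 0 /\ p \is a polyOver [in F] & root p x].

(* In the next definitions the fields are subfields of an ambient field L, and
   their polynomials are the polynomials over L with coefficients in them. *)
Definition valuation_ring (L : fieldType) (F R : set L) : Prop :=
  [/\ R `<` F, subring_closed [in R]
    & forall x, x \in F -> x \in R \/ x^-1 \in R].

Definition nonunits (L : fieldType) (R : set L) : set L :=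
  [set x | x \in R /\ ~ (exists2 y, y \in R & x * y = 1)].

Definition henselian (L : fieldType) (R : set L) : Prop :=
  forall (p : {poly L}) (a : L),
    p \is monic -> p \is a polyOver [in R] -> a \in R ->
    p.[a] \in nonunits R -> p^`().[a] \notin nonunits R ->
  exists b, [/\ b \in R, root p b & b - a \in nonunits R].

Definition admits_henselian_coarsening (L : fieldType) (F R : set L) : Prop :=
  exists R' : set L, [/\ valuation_ring F R', henselian R' & R `<=` R'].

Definition asymp (L : valued_field) (r t : L) : Prop :=
  exists n : nat, (0 < n)%N /\
    ((vle (vval (r ^+ n)) (vval t) && vle (vval t) (vval (r ^+ n.+1))) \/
     (vle (vval (t ^+ n)) (vval r) && vle (vval r) (vval (t ^+ n.+1)))).

Definition much_less (L : valued_field) (r t : L) : Prop :=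
  ~ asymp r t /\ vlt (vval r) (vval t).

(* The t_i are taken nonzero: for m = 1 the value t_1 = 0 has to be excluded,
   since the trace of the valuation ring on the algebraic closure of the prime
   field can be that whole field, hence not a valuation ring of it. *)
Definition prohenselian_degree (L : valued_field) (n : nat) : Prop :=
  forall (m : nat) (t : 'I_m -> L),
    (1 <= m <= n)%N ->
    (forall i, t i \in valideal L /\ t i != 0) ->
    (forall i j : 'I_m, j = i.+1 :> nat -> much_less (t i) (t j)) ->
  let F := rel_alg_closure (generated_subfield (range t)) in
  admits_henselian_coarsening F (F `&` [set` valring L]).

Definition power_index : Type := {k : nat | (1 < k)%N}.

(* Terms and formulas whose free variables are indexed by 'I_n; a quantifier
   binds the variable of index 0 and shifts the others. *)
Inductive term (n : nat) : Type :=
  | Var of 'I_n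
  | Zero
  | One
  | Add of term n & term n
  | Opp of term n
  | Mul of term n & term n.

Inductive formula : nat -> Type :=
  | Eq n of term n & term n : formula n
  | InO n of term n : formula n
  | InP n of power_index & term n : formula n
  | Bot n : formula n
  | Not n of formula n : formula n
  | And n of formula n & formula n : formula n
  | Or n of formula n & formula n : formula n
  | Imp n of formula n & formula n : formula n
  | Forall n of formula n.+1 : formula n
  | Exists n of formula n.+1 : formula n.

Definition sentence : Type := formula 0.

Fixpoint quantifier_free n (f : formula n) : bool :=
  match f with
  | Eq _ _ _ | InO _ _ | InP _ _ _ | Bot _ => true
  | Not _ f => quantifier_free f
  | And _ f g | Or _ f g | Imp _ f g => quantifier_free f && quantifier_free g
  | Forall _ _ | Exists _ _ => false
  end.

Record mac_structure := MacStructure {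
  mac_sort :> Type;
  mac_zero : mac_sort;
  mac_one : mac_sort;
  mac_add : mac_sort -> mac_sort -> mac_sort;
  mac_opp : mac_sort -> mac_sort;
  mac_mul : mac_sort -> mac_sort -> mac_sort;
  mac_O : set mac_sort;
  mac_P : power_index -> set mac_sort
}.

Section Semantics.
Variable M : mac_structure.

Fixpoint eval n (e : 'I_n -> M) (t : term n) : M :=
  match t with
  | Var i => e i
  | Zero => mac_zero M
  | One => mac_one M
  | Add s t => mac_add (eval e s) (eval e t)
  | Opp s => mac_opp (eval e s)
  | Mul s t => mac_mul (eval e s) (eval e t)
  end.

Definition env_cons n (x : M) (e : 'I_n -> M) (i : 'I_n.+1) : M :=
  if unlift ord0 i is Some j then e j else x.

Fixpoint holds n (f : formula n) : ('I_n -> M) -> Prop :=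
  match f with
  | Eq _ s t => fun e => eval e s = eval e t
  | InO _ t => fun e => mac_O (eval e t)
  | InP _ k t => fun e => mac_P k (eval e t)
  | Bot _ => fun _ => False
  | Not _ f => fun e => ~ holds f e
  | And _ f g => fun e => holds f e /\ holds g e
  | Or _ f g => fun e => holds f e \/ holds g e
  | Imp _ f g => fun e => holds f e -> holds g e
  | Forall _ f => fun e => forall x, holds f (env_cons x e)
  | Exists _ f => fun e => exists x, holds f (env_cons x e)
  end.

Definition empty_env (i : 'I_0) : M := mac_zero M.

Definition satisfies (s : sentence) : Prop := holds s empty_env.

End Semantics.

Definition Th (M : mac_structure) : set sentence := [set s | satisfies M s].

Definition is_model (T : set sentence) (M : mac_structure) : Prop :=
  forall s, T s -> satisfies M s.

Definition admits_qe (T : set sentence) : Prop :=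
  forall n (f : formula n), exists g : formula n,
    quantifier_free g /\
    (forall M : mac_structure, is_model T M ->
      forall e : 'I_n -> M, holds f e <-> holds g e).

Definition elementarily_equivalent (M N : mac_structure) : Prop :=
  forall s : sentence, satisfies M s <-> satisfies N s.

Definition Mac (L : valued_field) : mac_structure := {|
  mac_sort := L;
  mac_zero := 0;
  mac_one := 1;
  mac_add := +%R;
  mac_opp := -%R;
  mac_mul := *%R;
  mac_O := [set` valring L];
  mac_P := fun k => [set x | x != 0 /\ exists y : L, x = y ^+ val k]
|}.

(* Main.v *)
(* By the omitting types theorem it is enough to show that, over Th(K), no
   formula chi(s,t) isolates the type "s, t are nonzero infinitesimals and
   s << t"; a model omitting this type has rank 1.  By quantifier elimination
   chi can be taken quantifier-free.  If chi(s,t) holds with s << t, then the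
   henselian coarsenings on Q(s)^K and Q(s,t)^K make every nonzero integer
   polynomial p(s,t) equal to c s^a t^b times an n-th power, where c s^a t^b is
   its monomial that is lowest in t first and then in s.  Put s' = s t^N and
   t' = t^(1 + N m), where N = m!.  For m large, that monomial still dominates
   p(s',t'), and s', t' lie in the N-th power classes of s, t; so chi(s',t')
   holds, although s' and t' are comparable. *)
Require Import Defs.
From HB Require Import structures.
From mathcomp Require Import all_boot all_order all_algebra.
From mathcomp Require Import boolp classical_sets.
From mathcomp Require Import ring zify.

Set Implicit Arguments.
Unset Strict Implicit.
Unset Printing Implicit Defensive.

Import Order.TTheory GRing.Theory Num.Theory.
Local Open Scope ring_scope.
Local Open Scope quotient_scope.

(** * Valuation rings and henselian coarsenings *)

(** Since Th(K) is complete, a formula consistent with it is realized in K itself, so both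
    hypotheses on K apply directly to such a formula. The source of powers is Hensel's lemma for X^n
    - (1 + e). The obstacle is that an infinitesimal e may become a unit in the henselian
    coarsening. This is excluded when each element of the field is carried into the valuation ring
    by some power of e, because the coarsening is proper. In Q(s)^K this holds for e = s z with z
    integral. In Q(s,t)^K it fails for e = s, as s^k / t is never integral, but it holds for e = (t
    / s^a) z. Hence both fields are used: the quotient of p(s,t) by its lowest monomial is split
    into a factor 1 + s z over Q(s) and a factor 1 + (t / s^a) z over Q(s,t). For p(s',t') all
    correction terms are already multiples of t / s^a, so the field Q(s,t) of the original pair
    settles it although s' and t' are comparable. *)

Lemma polyOver_setP (R : nzRingType) (S : set R) (p : {poly R}) : S 0 ->
  p \is a polyOver [in S] <-> forall i, S p`_i.
Proof.
move=> S0; split=> [pS i|pS].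
  have [ip|/(nth_default 0) -> //] := ltnP i (size p).
  by rewrite -in_setE; move/(all_nthP 0): pS; apply.
by apply/(all_nthP 0) => i _; apply/mem_set.
Qed.

Section Valuation.
Variable K : valued_field.
Implicit Types x y z : K.

Lemma vval1 : vval (1 : K) = Some 0.
Proof.
case E: (vval (1 : K)) => [g|]; last by move/vval_infty/eqP: E; rewrite oner_eq0.
have := @vvalM K 1 1; rewrite mulr1 E /= => -[] /esym/eqP.
by rewrite -subr_eq0 addrK => /eqP ->.
Qed.

(** Turns comparisons of values into membership of quotients in the valuation ring, the form in
    which the estimates below are stated. *)
Lemma vle_div x y : x != 0 -> vle (vval x) (vval y) = (y / x \in valring K).
Proof.
move=> x0; rewrite inE; have := vvalM x (y / x).
rewrite mulrC divfK //.
case E: (vval x) => [g|]; last by move/vval_infty/eqP: E; rewrite (negPf x0).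
case: (vval (y / x)) => [h|] /= -> //=.
apply/idP/idP => [gh|h0]; last by rewrite -[X in X <= _]addr0; apply: og_add.
by have := og_add (- g) gh; rewrite addNr addKr.
Qed.

Lemma valring_inv_or x : x \in valring K \/ x^-1 \in valring K.
Proof.
have [->|x0] := eqVneq x 0; first by left; rewrite rpred0.
have := vle_div 1 x0; rewrite vval1 div1r => <-.
rewrite inE; case: (vval x) => [g|]; last by left.
by have /orP[|] := og_total 0 g; [left | right].
Qed.

Lemma validealP x : x \in valideal K <-> x = 0 \/ x^-1 \notin valring K.
Proof.
split=> [xM|].
  have [xO|xO] := boolP (x^-1 \in valring K); last by right.
  by left; apply: valideal_inv xM xO.
move=> [->|xO]; first exact: valideal0.
have [xO'|] := valring_inv_or x; last by rewrite (negPf xO).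
have [//|xM] := boolP (x \in valideal K); have [_ Vx] := valring_unit xO' xM.
by rewrite Vx in xO.
Qed.

Lemma validealMr x y : x \in valring K -> y \in valideal K -> x * y \in valideal K.
Proof.
by move=> xO yM; rewrite -[x * y]addr0; apply: valideal_idealr => //; exact: valideal0.
Qed.

Lemma valring_unitD x y : x != 0 -> x^-1 \in valring K -> x \in valring K ->
  y \in valideal K -> (x + y)^-1 \in valring K /\ x + y != 0.
Proof.
move=> x0 Vx xO yM.
have [||] := @valring_unit K (x + y).
- by rewrite rpredD // valideal_valring.
- apply/negP => xyM; have : x \in valideal K.
    rewrite -[x](addrK y) -[- y]mulN1r addrC; apply: valideal_idealr => //.
    by rewrite rpredN rpred1.
  by move/valideal_inv => /(_ Vx) /eqP; rewrite (negPf x0).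
by move=> -> ->.
Qed.

Hypothesis charKres : [pchar (residue_field K)] =i pred0.

(** An integer in the maximal ideal would vanish in the residue field. Residue characteristic 0
    enters the proof through this fact. *)
Lemma valring_nat_inv n : (0 < n)%N -> (n%:R : K) != 0 /\ (n%:R : K)^-1 \in valring K.
Proof.
move=> n0; apply: valring_unit; first by rewrite rpred_nat.
have := (pcharf0P _).1 charKres n; rewrite eqn0Ngt n0 /= => /negbT.
apply: contra => nM.
have -> : (n%:R : residue_field K) = \pi_(residue_field K) (n%:R : valring_type K).
  by rewrite rmorph_nat.
rewrite -[X in _ == X](rmorph0 \pi_{ideal_quot _}) -Quotient.idealrBE subr0.
rewrite inE; have -> : val (n%:R : valring_type K) = n%:R by rewrite rmorph_nat.
by [].
Qed.

Lemma valring_int_inv (c : int) : c != 0 -> (c%:~R : K) != 0 /\ (c%:~R : K)^-1 \in valring K.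
Proof.
case: c => n; first by rewrite eqz_nat -lt0n => /valring_nat_inv.
move=> _; rewrite NegzE rmorphN /= invrN rpredN oppr_eq0.
exact: (@valring_nat_inv n.+1).
Qed.

(* The last two hypotheses prevent e from being a unit of the coarsening, which
   would otherwise be the whole of F. *)
Lemma henselian_root (F : set K) (n : nat) (e : K) :
  admits_henselian_coarsening F (F `&` [set` valring K])%classic ->
  (0 < n)%N -> F n%:R^-1 -> F 1 -> F e -> e \in valring K ->
  (forall x, F x -> exists k, x * e ^+ k \in valring K) -> (forall x k, F x -> F (x * e ^+ k)) ->
  exists2 y, y != 0 & 1 + e = y ^+ n.
Proof.
move=> [R' [[ltR' sR' _] hR' OR']] n0 Fn F1 Fe Oe arch FM.
have [sub1 subB subM] := sR'.
have R'1 : R' 1 by apply: OR'; split=> //=; rewrite rpred1.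
have R'B x y : R' x -> R' y -> R' (x - y).
  by rewrite -!(in_setE R'); apply: subB.
have R'M x y : R' x -> R' y -> R' (x * y).
  by rewrite -!(in_setE R'); apply: subM.
have R'0 : R' 0 by rewrite -(subrr 1); apply: R'B.
have R'N x : R' x -> R' (- x) by move=> R'x; rewrite -sub0r; apply: R'B.
have R'X x k : R' x -> R' (x ^+ k).
  by move=> R'x; elim: k => [|k IH]; rewrite ?expr0 // exprS; apply: R'M.
have R'e : R' e by apply: OR'.
have e_nonunit : nonunits R' (- e).
  split=> [|[y]]; rewrite in_setE; first exact: R'N.
  move=> R'y ey1; case: ltR' => _; apply => x Fx.
  have [k xk] := arch x Fx.
  suff -> : x = (x * e ^+ k) * (- y) ^+ k.
    by apply: R'M; [apply: OR'; split=> //=; exact: FM | apply/R'X/R'N].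
  by rewrite -mulrA -exprMn mulrN -mulNr ey1 expr1n mulr1.
have unit_nonunit x y : R' y -> x * y = 1 -> ~ nonunits R' x.
  by move=> R'y xy [_]; apply; exists y; rewrite ?in_setE.
have [n1 Vn] := valring_nat_inv n0.
have R'Vn : R' n%:R^-1 by apply: OR'.
(* The approximate root is 1: the value there is [- e], a nonunit, and the derivative is [n], a
   unit. *)
pose p : {poly K} := 'X^n - (1 + e)%:P.
have [||||| b [R'b rb b1]] := hR' p 1.
- by rewrite monicXnsubC.
- apply/polyOver_setP => // i.
  rewrite coefB coefXn coefC; apply: (R'B); first by case: eqP.
  by case: eqP => // _; rewrite -[e]opprK; apply: R'B => //; apply: R'N.
- by rewrite in_setE.
- by rewrite in_setE !hornerE expr1n opprD addrA subrr sub0r.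
- apply/negP; rewrite in_setE /p derivB derivC subr0 derivXn hornerMn hornerXn expr1n.
  by apply: unit_nonunit R'Vn _; rewrite divff.
have : b ^+ n = 1 + e.
  by move: rb; rewrite /root /p !hornerE subr_eq0 => /eqP.
(* If [b = 0], the nonunit [b - 1] would be the unit [-1]. *)
exists b => //; apply/eqP => b0; move: b1; rewrite b0 sub0r in_setE.
by apply: (unit_nonunit _ (- 1)); [apply: R'N | rewrite mulrNN mulr1].
Qed.

End Valuation.

(** * Denominators in a relative algebraic closure *)

Section Bounded.
Variable K : valued_field.
Implicit Types x y z : K.

Lemma rel_alg_closure_sub (F : set K) x : subfield F -> F x -> rel_alg_closure F x.
Proof.
move=> [F1 FB _] Fx; exists ('X - x%:P); last by rewrite root_XsubC.
split; first by rewrite polyXsubC_eq0.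
have F0 : F 0 by have := FB _ _ F1 F1; rewrite subrr in_setE.
apply/polyOver_setP => // i; rewrite coefB coefX coefC -(in_setE F).
apply: FB; rewrite in_setE; last by case: eqP.
by case: eqP => //; rewrite -(in_setE F).
Qed.

Lemma generated_subfield_closed (A : set K) : subfield (generated_subfield A).
Proof.
split=> [|x y /set_mem xF /set_mem yF|x y /set_mem xF /set_mem yF];
  apply/mem_set => F FF; have [[F1 FB FV] _] := FF.
- exact/set_mem.
- by apply/set_mem/FB; apply/mem_set; [apply: xF | apply: yF].
- by apply/set_mem/FV; apply/mem_set; [apply: xF | apply: yF].
Qed.

Lemma finite_exponent (u : nat -> K) (p : K) n : p \in valring K ->
  (forall i, exists k, u i * p ^+ k \in valring K) ->
  exists k, forall i, (i < n)%N -> u i * p ^+ k \in valring K.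
Proof.
move=> pO uk; elim: n => [|n [k IH]]; first by exists 0%N.
have [l ul] := uk n; exists (k + l)%N => i; rewrite ltnS leq_eqVlt exprD.
move=> /orP[/eqP ->|ilt]; first by rewrite mulrCA rpredM // rpredX.
by rewrite mulrA rpredM ?IH // rpredX.
Qed.

(* If x is not integral, dividing its equation by x^(deg - 1) bounds v(x) below
   by the values of the coefficients. *)
Lemma rel_alg_closure_bounded (A G : set K) (p : K) :
  subring_closed [in A] -> (G `<=` A)%classic -> p \in valring K ->
  (forall a, A a -> a \in valring K) ->
  (forall a, A a -> a != 0 -> exists k, p ^+ k / a \in valring K) ->
  forall x, rel_alg_closure (generated_subfield G) x ->
  exists k, x * p ^+ k \in valring K.
Proof.
move=> [/set_mem A1 AB' AM'] GA pO AO Ap x [P [P0 PF] Px].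
have AB a b : A a -> A b -> A (a - b) by rewrite -!(in_setE A); apply: AB'.
have AM a b : A a -> A b -> A (a * b) by rewrite -!(in_setE A); apply: AM'.
have A0 : A 0 by rewrite -(subrr 1); apply: AB.
(* The fractions over [A] form a subfield containing [G], so they describe all coefficients of
   [P]. *)
pose Q := [set y : K | exists a b, [/\ A a, A b, b != 0 & y = a / b]]%classic.
have QF : subfield Q.
  split=> [|y z|y z]; rewrite !in_setE.
  - by exists 1, 1; split; rewrite ?oner_eq0 ?divr1.
  - move=> [a [b [Aa Ab b0 ->]]] [c [d [Ac Ad d0 ->]]].
    exists (a * d - c * b), (b * d); split; rewrite ?mulf_neq0 //.
      by apply: AB; apply: AM.
    + exact: AM.
    by field; rewrite b0 d0.
  - move=> [a [b [Aa Ab b0 ->]]] [c [d [Ac Ad d0 ->]]].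
    have [->|c0] := eqVneq c 0.
      by exists 0, 1; split; rewrite ?oner_eq0 // !mul0r invr0 mulr0.
    exists (a * d), (b * c); split; rewrite ?mulf_neq0 //; try exact: AM.
    by field; rewrite b0 c0 d0.
have EQ : (generated_subfield G `<=` Q)%classic.
  apply: smallest_sub => // y /GA Ay; exists y, 1.
  by split; rewrite ?oner_eq0 ?divr1.
have E0 : generated_subfield G 0.
  have [F1 FB _] := generated_subfield_closed G.
  by have := FB _ _ F1 F1; rewrite subrr in_setE.
move/(polyOver_setP _ E0) : PF => PE.
have PQ i : Q P`_i by exact: EQ.
have l0 : lead_coef P != 0 by rewrite lead_coef_eq0.
(* A coefficient over the leading one is [a * d] over [b * c], and a power of [p] absorbs this
   denominator. *)
have coefs i : exists k, P`_i / lead_coef P * p ^+ k \in valring K.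
  have [a [b [Aa Ab b0 ->]]] := PQ i.
  have [c [d [Ac Ad d0 lE]]] := PQ (size P).-1.
  have c0 : c != 0 by apply: contraNneq l0 => c0; rewrite /lead_coef lE c0 mul0r.
  have [k bck] := Ap (b * c) (AM _ _ Ab Ac) (mulf_neq0 b0 c0).
  exists k; rewrite /lead_coef lE.
  have -> : a / b / (c / d) * p ^+ k = (a * d) * (p ^+ k / (b * c)).
    by field; rewrite c0 b0 d0.
  by apply: rpredM => //; apply: rpredM; apply: AO.
have [k kP] := finite_exponent (size P) pO coefs.
have [xO|VxO] := valring_inv_or x; first by exists 0%N; rewrite mulr1.
have [->|x0] := eqVneq x 0; first by exists 0%N; rewrite mul0r rpred0.
exists k; move: Px; rewrite /root horner_coef.
case sP: (size P) => [|[|d]].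
- by move/eqP: sP; rewrite size_poly_eq0 (negPf P0).
- rewrite big_ord1 mulr1; have -> : P`_0 = lead_coef P by rewrite /lead_coef sP.
  by rewrite (negPf l0).
rewrite big_ord_recr /=.
have -> : P`_d.+1 = lead_coef P by rewrite /lead_coef sP.
rewrite addrC addr_eq0 => /eqP xE.
have -> : x * p ^+ k =
    - \sum_(i < d.+1) (P`_i / lead_coef P * p ^+ k) * x^-1 ^+ (d - i).
  have -> : x * p ^+ k = (lead_coef P * x ^+ d.+1) * (p ^+ k / lead_coef P / x ^+ d).
    by rewrite exprS; field; rewrite ?l0 ?x0 ?expf_neq0.
  rewrite xE mulNr mulr_suml; congr (- _); apply: eq_bigr => i _.
  have id : (i <= d)%N by rewrite -ltnS.
  have -> : x ^+ d = x ^+ (d - i) * x ^+ i by rewrite -exprD subnK.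
  rewrite exprVn.
  by field; rewrite ?x0 ?l0 ?expf_neq0.
rewrite rpredN rpred_sum // => i _.
by rewrite rpredM ?rpredX // kP // sP ltnS ltnW.
Qed.

End Bounded.

(** * Subfields and lowest terms of integer polynomials *)

Lemma poly_low_order (R : nzRingType) (p : {poly R}) : p != 0 ->
  exists b c q, c != 0 /\ p = 'X^b * (c%:P + 'X * q).
Proof.
elim/poly_ind: p => [|p c IH]; first by rewrite eqxx.
have [-> | c0] := eqVneq c 0; last first.
  by move=> _; exists 0%N, c, p; rewrite expr0 mul1r addrC commr_polyX.
rewrite addr0 => pX0; have p0 : p != 0 by apply: contraNneq pX0 => ->; rewrite mul0r.
have [b [d [q [d0 ->]]]] := IH p0; exists b.+1, d, q; split=> //.
by rewrite exprS -[RHS]mulrA; apply: commr_polyX.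
Qed.

Section SubfieldTheory.
Variables (K : fieldType) (F : set K).
Hypothesis FF : subfield F.

Lemma subfield1 : F 1. Proof. by case: FF => /set_mem. Qed.

Lemma subfieldB x y : F x -> F y -> F (x - y).
Proof. by case: FF => _ FB _ /mem_set Fx /mem_set Fy; apply/set_mem/FB. Qed.

Lemma subfield_div x y : F x -> F y -> F (x / y).
Proof. by case: FF => _ _ FV /mem_set Fx /mem_set Fy; apply/set_mem/FV. Qed.

Lemma subfield0 : F 0.
Proof. by rewrite -(subrr 1); apply: subfieldB; apply: subfield1. Qed.

Lemma subfieldD x y : F x -> F y -> F (x + y).
Proof.
move=> Fx Fy; rewrite -[y]opprK -[- y]sub0r; apply: subfieldB => //.
exact: subfieldB subfield0 Fy.
Qed.

Lemma subfieldM x y : F x -> F y -> F (x * y).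
Proof.
move=> Fx Fy; rewrite -[y]invrK -[y^-1]div1r; apply: subfield_div => //.
exact: subfield_div subfield1 Fy.
Qed.

Lemma subfieldX x k : F x -> F (x ^+ k).
Proof.
by move=> Fx; elim: k => [|k IH]; [exact: subfield1 | rewrite exprS; apply: subfieldM].
Qed.

Lemma subfield_nat n : F n%:R.
Proof.
elim: n => [|n IH]; first exact: subfield0.
by rewrite -addn1 natrD; apply: subfieldD => //; exact: subfield1.
Qed.

Lemma subfield_int (c : int) : F c%:~R.
Proof.
case: c => n; first exact: subfield_nat.
rewrite NegzE rmorphN /= -sub0r; apply: subfieldB; [exact: subfield0 |].
exact: (subfield_nat n.+1).
Qed.

(** Multiplying the coefficient of degree i by f^(d - i), with d the degree, turns the value at x
    into f^d P(x) at x f, and leaves the leading coefficient unchanged. *)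
Lemma rel_alg_closureMr x f : F f -> rel_alg_closure F x -> rel_alg_closure F (x * f).
Proof.
move=> Ff [P [P0 /(polyOver_setP _ subfield0) PF] Px].
have sP : (0 < size P)%N by rewrite lt0n size_poly_eq0.
exists (\poly_(i < size P) (P`_i * f ^+ ((size P).-1 - i))).
  split; last first.
    apply/(polyOver_setP _ subfield0) => i; rewrite coef_poly.
    by case: ifP => _; [apply: subfieldM; [|apply: subfieldX] | exact: subfield0].
  apply/eqP => /polyP /(_ (size P).-1); rewrite coef_poly prednK // leqnn subnn mulr1.
  by move/eqP; rewrite coef0 -/(lead_coef P) lead_coef_eq0 (negPf P0).
move: Px; rewrite /root horner_coef horner_poly => /eqP Px; apply/eqP.
transitivity (f ^+ (size P).-1 * \sum_(i < size P) P`_i * x ^+ i); last by rewrite Px mulr0.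
rewrite mulr_sumr; apply: eq_bigr => i _.
have iP : (i <= (size P).-1)%N by rewrite -ltnS prednK.
have -> : f ^+ (size P).-1 = f ^+ ((size P).-1 - i) * f ^+ i by rewrite -exprD subnK.
by rewrite exprMn; ring.
Qed.

End SubfieldTheory.

(** Written as a composite of ring morphisms so that the morphism structure can be copied. *)
Definition eval1 (R : comNzRingType) (x : R) : {poly int} -> R :=
  horner_eval x \o map_poly intr.
HB.instance Definition _ (R : comNzRingType) (x : R) :=
  GRing.RMorphism.copy (@eval1 R x) (horner_eval x \o map_poly intr).

Definition eval2 (R : comNzRingType) (x y : R) : {poly {poly int}} -> R :=
  horner_eval y \o map_poly (eval1 x).
HB.instance Definition _ (R : comNzRingType) (x y : R) :=
  GRing.RMorphism.copy (@eval2 R x y) (horner_eval y \o map_poly (eval1 x)).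

Section Eval.
Variable R : comNzRingType.
Implicit Types x y : R.

Lemma eval1C x c : eval1 x c%:P = c%:~R.
Proof. by rewrite /eval1 /= map_polyC /horner_eval hornerC. Qed.

Lemma eval1X x : eval1 x 'X = x.
Proof. by rewrite /eval1 /= map_polyX /horner_eval hornerX. Qed.

Lemma eval2C x y q : eval2 x y q%:P = eval1 x q.
Proof. by rewrite /eval2 /= map_polyC /horner_eval hornerC. Qed.

Lemma eval2X x y : eval2 x y 'X = y.
Proof. by rewrite /eval2 /= map_polyX /horner_eval hornerX. Qed.

Lemma eval1_low q : q != 0 -> exists b c r, c != 0 /\
  forall x, eval1 x q = x ^+ b * (c%:~R + x * eval1 x r).
Proof.
move=> /poly_low_order [b [c [r [c0 ->]]]]; exists b, c, r; split=> // x.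
by rewrite rmorphM rmorphXn rmorphD rmorphM /= !eval1X eval1C.
Qed.

(** The lowest coefficient in the second variable is a polynomial in the first, decomposed in turn.
    The data do not depend on the point, so the same monomial serves for a pair and for its
    shift. *)
Lemma eval2_low p : p != 0 -> exists a b c q r, c != 0 /\
  forall x y, eval2 x y p =
    y ^+ b * (x ^+ a * (c%:~R + x * eval1 x q) + y * eval2 x y r).
Proof.
move=> /poly_low_order [b [d [r [/eval1_low [a [c [q [c0 dE]]]] ->]]]].
exists a, b, c, q, r; split=> // x y.
by rewrite rmorphM rmorphXn rmorphD rmorphM /= !eval2X eval2C dE.
Qed.

End Eval.

Lemma eval1_ind (R : comNzRingType) (x : R) (P : R -> Prop) :
  (forall c : int, P c%:~R) -> P x -> (forall y z, P y -> P z -> P (y + z)) ->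
  (forall y z, P y -> P z -> P (y * z)) -> forall q, P (eval1 x q).
Proof.
move=> PC Px PD PM; elim/poly_ind => [|q c IH]; first by rewrite rmorph0 -(mulr0z 1).
by rewrite rmorphD rmorphM /= eval1X eval1C; apply: PD => //; apply: PM.
Qed.

Lemma eval2_ind (R : comNzRingType) (x y : R) (P : R -> Prop) :
  (forall c : int, P c%:~R) -> P x -> P y -> (forall y z, P y -> P z -> P (y + z)) ->
  (forall y z, P y -> P z -> P (y * z)) -> forall p, P (eval2 x y p).
Proof.
move=> PC Px Py PD PM; elim/poly_ind => [|q c IH]; first by rewrite rmorph0 -(mulr0z 1).
by rewrite rmorphD rmorphM /= eval2X eval2C; apply: (PD); [apply: PM | apply: eval1_ind].
Qed.

(** * Elements close to 1 are powers *)

Section Key.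
Variable K : valued_field.
Hypothesis charKres : [pchar (residue_field K)] =i pred0.
Implicit Types x y z s t : K.

Lemma int_valring (c : int) : c%:~R \in valring K.
Proof. exact: rpred_int. Qed.

Lemma eval1_valring s q : s \in valring K -> eval1 s q \in valring K.
Proof.
move=> sO; apply: (@eval1_ind _ s (fun x => x \in valring K)) => //.
- exact: int_valring.
- by move=> *; apply: rpredD.
- by move=> *; apply: rpredM.
Qed.

Lemma eval2_valring s t p : s \in valring K -> t \in valring K -> eval2 s t p \in valring K.
Proof.
move=> sO tO; apply: (@eval2_ind _ s t (fun x => x \in valring K)) => //.
- exact: int_valring.
- by move=> *; apply: rpredD.
- by move=> *; apply: rpredM.
Qed.

Lemma unit_int_add c x z : c != 0 -> x \in valideal K -> z \in valring K ->
  (c%:~R + x * z)^-1 \in valring K /\ c%:~R + x * z != 0.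
Proof.
move=> /(valring_int_inv charKres)[c0 Vc] xM zO; apply: valring_unitD => //.
  exact: int_valring.
by rewrite mulrC; apply: validealMr.
Qed.

Definition nonzero_power n x := exists2 y, y != 0 & x = y ^+ n.

Lemma nonzero_powerMl n x y : nonzero_power n x -> nonzero_power n (x * y) <-> nonzero_power n y.
Proof.
move=> [u u0 ->]; split=> -[w w0 E].
  exists (w / u); first by rewrite mulf_neq0 ?invr_eq0.
  by rewrite expr_div_n -E mulrC mulKf // expf_neq0.
by exists (u * w); rewrite ?mulf_neq0 // exprMn -E.
Qed.

(** As [e] lies in the generated field itself, [rel_alg_closureMr] gives the stability under
    multiplication by its powers. *)
Lemma closure_power (n : nat) (G : set K) e :
  let E := generated_subfield G in
  admits_henselian_coarsening (rel_alg_closure E)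
    (rel_alg_closure E `&` [set` valring K])%classic ->
  (0 < n)%N -> E e -> e \in valring K ->
  (forall x, rel_alg_closure E x -> exists k, x * e ^+ k \in valring K) ->
  nonzero_power n (1 + e).
Proof.
move=> E hens n0 Ee eO arch.
have FE := generated_subfield_closed G; have EF := rel_alg_closure_sub FE.
apply: (henselian_root charKres hens) => //.
- apply: EF; rewrite -div1r; apply: (subfield_div FE); first exact: (subfield1 FE).
  exact: (subfield_nat FE).
- by apply: EF; apply: (subfield1 FE).
- exact: EF.
- by move=> x k; apply: (rel_alg_closureMr FE); apply: (subfieldX FE).
Qed.

Hypothesis prohensK : prohenselian_degree K 2.

Section OneVariable.
Variable s : K.
Hypotheses (s0 : s != 0) (sM : s \in valideal K).
Let G1 := range (fun _ : 'I_1 => s).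
Let E1 := generated_subfield G1.

Let sO : s \in valring K. Proof. exact: valideal_valring. Qed.

Lemma gen_subfield1 q : E1 (eval1 s q).
Proof.
have FE := generated_subfield_closed G1.
apply: eval1_ind; [exact: (subfield_int FE) | | exact: (subfieldD FE) | exact: (subfieldM FE)].
by move=> F [_]; apply; exists ord0.
Qed.

(** By [eval1_low] a nonzero element of Z[s] is a power of [s] times a unit, so powers of [s] clear
    all denominators. *)
Lemma closure1_bounded x : rel_alg_closure E1 x -> exists k, x * s ^+ k \in valring K.
Proof.
apply: (@rel_alg_closure_bounded K [set x | exists q, x = eval1 s q]%classic) => //.
- split=> [|_ _ /set_mem [q ->] /set_mem [r ->]|_ _ /set_mem [q ->] /set_mem [r ->]];
    apply/mem_set.
  + by exists 1; rewrite rmorph1.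
  + by exists (q - r); rewrite rmorphB.
  + by exists (q * r); rewrite rmorphM.
- by move=> _ [_ _ <-]; exists 'X; rewrite eval1X.
- by move=> _ [q ->]; apply: eval1_valring.
- move=> _ [q ->]; have [->|/(@eval1_low K)] := eqVneq q 0; first by rewrite rmorph0 eqxx.
  move=> [b [c [r [c0 qE]]]] _; exists b; rewrite qE.
  have [Vu u0] := unit_int_add c0 sM (eval1_valring r sO).
  by rewrite invfM mulrA divff ?expf_neq0 // mul1r.
Qed.

Lemma power_near_one1 n z : (0 < n)%N -> E1 z -> z \in valring K ->
  nonzero_power n (1 + s * z).
Proof.
move=> n0 Ez zO.
apply: (@closure_power n G1) => //.
- apply: (@prohensK 1 (fun _ => s)) => //.
  by move=> i j; rewrite !ord1.
- apply: (subfieldM (@generated_subfield_closed _ _)) => //.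
  by rewrite -[s]eval1X; apply: gen_subfield1.
- exact: rpredM.
move=> x /closure1_bounded [k xk]; exists k.
by rewrite exprMn mulrA rpredM // rpredX.
Qed.

End OneVariable.

Definition pair_env T (s t : T) (i : 'I_2) : T := if i == ord0 then s else t.

Section TwoVariables.
Variables s t : K.
Hypotheses (s0 : s != 0) (sM : s \in valideal K) (t0 : t != 0).
Hypothesis st : forall n, s ^+ n / t \notin valring K.
Let G2 := range (pair_env s t).
Let E2 := generated_subfield G2.

Let sO : s \in valring K. Proof. exact: valideal_valring. Qed.

Lemma below_div n : t / s ^+ n \in valring K.
Proof.
have [|] := valring_inv_or (t / s ^+ n) => //.
by rewrite invfM invrK mulrC (negPf (st n)).
Qed.

Lemma below_valideal n : t / s ^+ n \in valideal K.
Proof. by apply/validealP; right; rewrite invfM invrK mulrC; exact: st. Qed.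

Let tM : t \in valideal K.
Proof. by have := below_valideal 0; rewrite expr0 divr1. Qed.

Let tO : t \in valring K. Proof. exact: valideal_valring. Qed.

Lemma below_much_less : much_less s t.
Proof.
have vst x y : x != 0 -> vle (vval x) (vval y) = (y / x \in valring K) by exact: vle_div.
split; last by rewrite /vlt vst //; have := st 1; rewrite expr1.
case=> n [n0 [/andP[_]|/andP[]]].
  by rewrite vst // (negPf (st _)).
rewrite vst ?expf_neq0 // => snt _; have /negP := st 1; apply; rewrite expr1.
have -> : s / t = s / t ^+ n * t ^+ n.-1.
  by rewrite -{1}(prednK n0) exprS; field; rewrite t0 expf_neq0.
by rewrite rpredM // rpredX.
Qed.

Lemma gen_subfield2 p : E2 (eval2 s t p).
Proof.
have FE := generated_subfield_closed G2.
apply: eval2_ind; [exact: (subfield_int FE) | | | exact: (subfieldD FE) | exact: (subfieldM FE)].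
  by move=> F [_]; apply; exists ord0.
by move=> F [_]; apply; exists ord_max.
Qed.

Lemma closure2_bounded x : rel_alg_closure E2 x -> exists k, x * t ^+ k \in valring K.
Proof.
apply: (@rel_alg_closure_bounded K [set x | exists q, x = eval2 s t q]%classic) => //.
- split=> [|_ _ /set_mem [q ->] /set_mem [r ->]|_ _ /set_mem [q ->] /set_mem [r ->]];
    apply/mem_set.
  + by exists 1; rewrite rmorph1.
  + by exists (q - r); rewrite rmorphB.
  + by exists (q * r); rewrite rmorphM.
- move=> _ [i _ <-]; rewrite /pair_env; case: ifP => _.
    by exists ('X%:P); rewrite eval2C eval1X.
  by exists 'X; rewrite eval2X.
- by move=> _ [q ->]; apply: eval2_valring.
- move=> _ [q ->]; have [->|/(@eval2_low K)] := eqVneq q 0; first by rewrite rmorph0 eqxx.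
  (* The value is t^b s^a times a unit, because t / s^a is infinitesimal. The exponent exceeds [b]
     by one so that the extra factor [t] pays for s^a. *)
  move=> [a [b [c [q1 [r [c0 qE]]]]]] _; exists b.+1; rewrite qE.
  have [Vu u0] := unit_int_add c0 sM (eval1_valring q1 sO).
  set u := _ + _ in Vu u0 *.
  have uO : u \in valring K.
    by rewrite rpredD ?int_valring // rpredM // eval1_valring.
  have [] := @valring_unitD K u (eval2 s t r * (t / s ^+ a)) => //.
    by apply: validealMr; [exact: eval2_valring | exact: below_valideal].
  set w := _ + _ => Vw w0.
  have -> : s ^+ a * u + t * eval2 s t r = s ^+ a * w.
    by rewrite /w; field; rewrite expf_neq0.
  have -> : t ^+ b.+1 / (t ^+ b * (s ^+ a * w)) = t / s ^+ a * w^-1.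
    by rewrite exprS; field; rewrite w0 !expf_neq0.
  by rewrite rpredM ?below_div.
Qed.

Lemma power_near_one2 n a z : (0 < n)%N -> E2 z -> z \in valring K ->
  nonzero_power n (1 + t / s ^+ a * z).
Proof.
move=> n0 Ez zO.
have FE := generated_subfield_closed G2.
apply: (@closure_power n G2) => //.
- apply: (@prohensK 2 (pair_env s t)) => // [i|i j ij].
    by rewrite /pair_env; case: ifP.
  rewrite /pair_env -!val_eqE /= ij /=.
  have -> : (val i == 0%N) = true; last exact: below_much_less.
  by case: j ij => [[|[|j]]] //= _ [<-].
- apply: (subfieldM FE) => //; apply: (subfield_div FE).
    by rewrite -(eval2X s t); apply: gen_subfield2.
  by apply: (subfieldX FE); rewrite -[s]eval1X -(eval2C s t); apply: gen_subfield2.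
- by rewrite rpredM ?below_div.
(* The exponent is doubled: half of the factors [t] bring [x] into the valuation ring, the other
   half cancel the powers of [s] in the denominator. *)
move=> x /closure2_bounded [k xk]; exists (k + k)%N.
have -> : x * (t / s ^+ a * z) ^+ (k + k) =
    (x * t ^+ k) * (t / s ^+ (a + a)) ^+ k * z ^+ (k + k).
  rewrite !exprMn !exprD !exprVn !exprMn; field.
  by rewrite !expf_neq0.
by apply: rpredM; [apply: rpredM => //; apply/rpredX/below_div | exact: rpredX].
Qed.

End TwoVariables.

End Key.

(** * Quantifier-free formulas in two infinitesimals *)

(** The colouring [c] sends each variable to [s] or [t], so that inductions can run over formulas in
    any number of variables. The first variable is the inner one, ['X%:P]. *)
Fixpoint term_poly n (c : 'I_n -> bool) (u : term n) : {poly {poly int}} :=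
  match u with
  | Var i => if c i then 'X%:P else 'X
  | Zero => 0
  | One => 1
  | Add u v => term_poly c u + term_poly c v
  | Opp u => - term_poly c u
  | Mul u v => term_poly c u * term_poly c v
  end.

Lemma eval_term_poly (K : valued_field) n (c : 'I_n -> bool) (u : term n) (x y : K) :
  @eval (Mac K) n (fun i => if c i then x else y) u = eval2 x y (term_poly c u).
Proof.
elim: u => [i|||u IHu v IHv|u IHu|u IHu v IHv] /=.
- by case: ifP; rewrite ?eval2C ?eval1X ?eval2X.
- by rewrite rmorph0.
- by rewrite rmorph1.
- by rewrite rmorphD IHu IHv.
- by rewrite rmorphN IHu.
- by rewrite rmorphM IHu IHv.
Qed.

Section Transfer.
Variable K : valued_field.
Hypothesis charKres : [pchar (residue_field K)] =i pred0.
Hypothesis prohensK : prohenselian_degree K 2.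
Variables s t : K.
Hypotheses (s0 : s != 0) (sM : s \in valideal K) (t0 : t != 0).
Hypothesis st : forall n, s ^+ n / t \notin valring K.
Let E2 := generated_subfield (range (pair_env s t)).

Let sO : s \in valring K. Proof. exact: valideal_valring. Qed.
Let tO : t \in valring K.
Proof. by have := below_div st 0; rewrite expr0 divr1. Qed.

Let FE : subfield E2. Proof. exact: generated_subfield_closed. Qed.
Let Es : E2 s. Proof. by move=> F [_]; apply; exists ord0. Qed.
Let Et : E2 t. Proof. by move=> F [_]; apply; exists ord_max. Qed.

(* The factor b in the exponent of [shift2] makes the order of a monomial of
   degree at most b in the first variable depend on its degree in the second
   variable first, as for s << t. *)
Definition shift1 b := s * t ^+ b`!.
Definition shift2 b := t * t ^+ (b`! * b).

(** The polynomial is its lowest monomial times two factors close to 1, a power by the case of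
    Q(s,t) and a power by the case of Q(s). *)
Lemma power_eval2 k a b c q r : (0 < k)%N -> (c : int) != 0 ->
  nonzero_power k (t ^+ b * (s ^+ a * (c%:~R + s * eval1 s q) + t * eval2 s t r)) <->
  nonzero_power k (t ^+ b * s ^+ a * c%:~R).
Proof.
move=> k0 c0; have [Vu u0] := unit_int_add charKres c0 sM (eval1_valring q sO).
have [c1 Vc] := valring_int_inv charKres c0.
set u := _ + _ in Vu u0 *.
have E1E2 : E2 u.
  apply: (subfieldD FE); first exact: subfield_int.
  apply: (subfieldM FE) => //; rewrite -(eval2C s t); exact: gen_subfield2.
have -> : t ^+ b * (s ^+ a * u + t * eval2 s t r) =
    (1 + t / s ^+ a * (eval2 s t r / u)) *
    ((1 + s * (eval1 s q / c%:~R)) * (t ^+ b * s ^+ a * c%:~R)).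
  have -> : 1 + s * (eval1 s q / c%:~R) = u / c%:~R by rewrite /u; field.
  by field; rewrite c1 u0 expf_neq0.
rewrite nonzero_powerMl; last first.
  apply: (power_near_one2 charKres) => //.
    by apply: (subfield_div FE) => //; exact: gen_subfield2.
  by rewrite rpredM // eval2_valring.
rewrite nonzero_powerMl //; apply: (power_near_one1 charKres) => //.
  by apply: (subfield_div (@generated_subfield_closed _ _));
    [exact: gen_subfield1 | exact: subfield_int (@generated_subfield_closed _ _) _].
by rewrite rpredM // eval1_valring.
Qed.

(** After the shift a single factor close to 1 remains, and the lowest monomials of the two pairs
    differ by a power with exponent [m]!, hence by a k-th power as [k] divides it. *)
Lemma power_eval2_shift k a b c q r m (s' := shift1 m) (t' := shift2 m) :
  (0 < k)%N -> (c : int) != 0 -> (k <= m)%N -> (a <= m)%N ->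
  nonzero_power k (t' ^+ b * (s' ^+ a * (c%:~R + s' * eval1 s' q) + t' * eval2 s' t' r)) <->
  nonzero_power k (t ^+ b * s ^+ a * c%:~R).
Proof.
move=> k0 c0 km am; have [c1 Vc] := valring_int_inv charKres c0.
have Es' : E2 s' by apply: (subfieldM FE) => //; apply: (subfieldX FE).
have Et' : E2 t' by apply: (subfieldM FE) => //; apply: (subfieldX FE).
have s'O : s' \in valring K by rewrite rpredM // rpredX.
have t'O : t' \in valring K by rewrite rpredM // rpredX.
(* The two summands come from writing s' and t' / s'^a as multiples of t / s^a; the second one uses
   [a <= m]. *)
pose z := (s ^+ a.+1 * t ^+ (m`!).-1 * eval1 s' q +
           t ^+ (m`! * (m - a)) * eval2 s' t' r) / c%:~R.
have /dvdnP[d dE] : (k %| m`!)%N by rewrite dvdn_fact // k0.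
have -> : t' ^+ b * (s' ^+ a * (c%:~R + s' * eval1 s' q) + t' * eval2 s' t' r) =
    (1 + t / s ^+ a * z) * ((t ^+ (d * (m * b + a))) ^+ k * (t ^+ b * s ^+ a * c%:~R)).
  have t'E : t' = t ^+ (m`! * (m - a)) * (t ^+ m`!) ^+ a * t.
    by rewrite /t' /shift2 -exprM -exprD -mulnDr subnK // mulrC.
  have tE : t ^+ m`! = t ^+ (m`!).-1 * t by rewrite -exprSr prednK // fact_gt0.
  have s'E : s' * s ^+ a = s ^+ a.+1 * t ^+ (m`!).-1 * t.
    by rewrite /s' /shift1 tE exprS; ring.
  have pE : (t ^+ (d * (m * b + a))) ^+ k = (t ^+ (m`! * m)) ^+ b * (t ^+ m`!) ^+ a.
    by rewrite -!exprM -exprD dE; congr (_ ^+ _); ring.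
  rewrite pE; have -> : t' ^+ b = t ^+ b * (t ^+ (m`! * m)) ^+ b by rewrite -exprMn.
  have -> : 1 + t / s ^+ a * z = 1 + (s' * eval1 s' q +
       t ^+ (m`! * (m - a)) * t / s ^+ a * eval2 s' t' r) / c%:~R.
    rewrite /z; move: (eval1 s' q) (eval2 s' t' r) => e1 e2.
    have -> : s' = s ^+ a.+1 * t ^+ (m`!).-1 * t / s ^+ a.
      by rewrite -s'E mulfK // expf_neq0.
    by field; rewrite c1 expf_neq0.
  rewrite [X in _ + X * _]t'E.
  have -> : s' ^+ a = s ^+ a * (t ^+ m`!) ^+ a by rewrite -exprMn.
  by field; rewrite c1 expf_neq0.
rewrite nonzero_powerMl.
  rewrite nonzero_powerMl //; exists (t ^+ (d * (m * b + a))) => //.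
  by rewrite expf_neq0.
apply: (power_near_one2 charKres) => //.
  apply: (subfield_div FE); last exact: subfield_int.
  apply: (subfieldD FE); apply: (subfieldM FE).
  - by apply: (subfieldM FE); apply: (subfieldX FE).
  - by apply: eval1_ind => //; [exact: (subfield_int FE)|exact: (subfieldD FE)|exact: (subfieldM FE)].
  - exact: (subfieldX FE).
  - by apply: eval2_ind => //; [exact: (subfield_int FE)|exact: (subfieldD FE)|exact: (subfieldM FE)].
apply: rpredM => //; apply: rpredD; apply: rpredM; rewrite ?eval1_valring ?eval2_valring //.
  by rewrite rpredM ?rpredX.
by rewrite rpredX.
Qed.

Lemma eval2_shift_power p k : (0 < k)%N -> p != 0 ->
  exists B, forall m, (B <= m)%N ->
  nonzero_power k (eval2 s t p) <-> nonzero_power k (eval2 (shift1 m) (shift2 m) p).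
Proof.
move=> k0 /(@eval2_low K) [a [b [c [q [r [c0 pE]]]]]].
(* Large enough for [k] to divide [m]! and for [m] to bound the degree [a] in the first variable. *)
exists (k + a)%N => m km; rewrite !pE power_eval2 // power_eval2_shift //; lia.
Qed.

(** A nonzero first power is just a nonzero element, so this is the case k = 1 of [power_eval2]. *)
Lemma eval2_neq0 p : p != 0 -> eval2 s t p != 0.
Proof.
move=> /(@eval2_low K) [a [b [c [q [r [c0 ->]]]]]].
have [c1 _] := valring_int_inv charKres c0.
have [_ H] := @power_eval2 1 a b c q r isT c0.
have [|y y0 ->] := H; last by rewrite expr1.
by exists (t ^+ b * s ^+ a * c%:~R); rewrite ?expr1 // !mulf_neq0 ?expf_neq0.
Qed.

Lemma eval2_shift_neq0 p : p != 0 -> exists B, forall m, (B <= m)%N ->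
  eval2 (shift1 m) (shift2 m) p != 0.
Proof.
move=> p0; have [B BP] := @eval2_shift_power p 1 isT p0; exists B => m /BP [H _].
have [|y y0 ->] := H; last by rewrite expr1.
by exists (eval2 s t p); rewrite ?eval2_neq0 ?expr1.
Qed.

(** Each atom is stable for large [m]. A nontrivial equation fails at both pairs, membership in the
    valuation ring holds at both since terms are integer polynomials in integral elements, and power
    atoms are [eval2_shift_power]. Connectives take the maximum of the bounds. *)
Lemma holds_shift n (f : formula n) (c : 'I_n -> bool) : quantifier_free f ->
  exists B, forall m, (B <= m)%N ->
    @holds (Mac K) n f (fun i => if c i then s else t) <->
    @holds (Mac K) n f (fun i => if c i then shift1 m else shift2 m).
Proof.
elim: f c => {n}.
- move=> n u v c _ /=; have [E|p0] := eqVneq (term_poly c u - term_poly c v) 0.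
    exists 0%N => m _; rewrite !eval_term_poly.
    by move/eqP: E; rewrite subr_eq0 => /eqP ->.
  have [B BP] := eval2_shift_neq0 p0; exists B => m /BP.
  have := eval2_neq0 p0; rewrite !rmorphB !eval_term_poly !subr_eq0.
  by move=> /eqP H1 /eqP H2.
- move=> n u c _; exists 0%N => m _ /=; rewrite !eval_term_poly.
  have s'O : shift1 m \in valring K by rewrite rpredM // rpredX.
  have t'O : shift2 m \in valring K by rewrite rpredM // rpredX.
  by split=> _; apply: eval2_valring.
- move=> n k u c _ /=; have [E|p0] := eqVneq (term_poly c u) 0.
    by exists 0%N => m _; rewrite !eval_term_poly E !rmorph0.
  have k0 : (0 < val k)%N by case: (k) => j /= /ltnW.
  have powE x : (x != 0 /\ exists y : K, x = y ^+ val k) <-> nonzero_power (val k) x.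
    split=> [[x0 [y xE]]|[y y0 ->]]; last by split; [rewrite expf_neq0 | exists y].
    by exists y => //; apply: contraNneq x0 => y0; rewrite xE y0 expr0n gtn_eqF.
  have [B BP] := eval2_shift_power k0 p0; exists B => m /BP.
  by rewrite !eval_term_poly -!powE.
- by exists 0%N.
- move=> n f IH c /= /(IH c) [B BP]; exists B => m /BP; tauto.
- move=> n f IHf g IHg c /= /andP[/(IHf c) [B BP] /(IHg c) [D DP]].
  exists (maxn B D) => m; rewrite geq_max => /andP[/BP + /DP]; tauto.
- move=> n f IHf g IHg c /= /andP[/(IHf c) [B BP] /(IHg c) [D DP]].
  exists (maxn B D) => m; rewrite geq_max => /andP[/BP + /DP]; tauto.
- move=> n f IHf g IHg c /= /andP[/(IHf c) [B BP] /(IHg c) [D DP]].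
  exists (maxn B D) => m; rewrite geq_max => /andP[/BP + /DP]; tauto.
- by [].
- by [].
Qed.

End Transfer.

(** Provides the density hypothesis of the omitting types theorem: no formula forces its solutions
    to be incomparable. *)
Lemma comparable_solution (K : valued_field)
    (charKres : [pchar (residue_field K)] =i pred0)
    (prohensK : prohenselian_degree K 2) (qeK : admits_qe (Th (Mac K)))
    (f : formula 2) (s t : K) :
  s != 0 -> s \in valideal K -> t != 0 -> @holds (Mac K) 2 f (pair_env s t) ->
  exists s' t' n, [/\ t' != 0, s' ^+ n / t' \in valring K & @holds (Mac K) 2 f (pair_env s' t')].
Proof.
move=> s0 sM t0; have [g [gqf /(_ (Mac K)) fg]] := qeK 2 f.
have {fg}fg : forall e : 'I_2 -> Mac K, holds f e <-> holds g e by exact: fg.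
move=> hf; have [[n stn]|st] := pselect (exists n, s ^+ n / t \in valring K).
  by exists s, t, n.
have {}st n : s ^+ n / t \notin valring K by apply/negP => H; apply: st; exists n.
have tO : t \in valring K by have := below_div st 0; rewrite expr0 divr1.
have sO : s \in valring K by exact: valideal_valring.
have [B /(_ B (leqnn _)) [H _]] :=
  holds_shift charKres prohensK s0 sM t0 st (fun i : 'I_2 => i == ord0) gqf.
(* With M = 1 + [B]! [B] one has t' = t^M, and s' is divisible by [t] because [B]! is positive;
   hence t' divides s'^M. *)
exists (shift1 s t B), (shift2 t B), (1 + B`! * B)%N; split.
- by rewrite mulf_neq0 // expf_neq0.
- have E M : (s * t ^+ B`!) ^+ M / t ^+ M = s ^+ M * t ^+ ((B`!).-1 * M).
    have -> : (s * t ^+ B`!) ^+ M = s ^+ M * t ^+ ((B`!).-1 * M) * t ^+ M.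
      by rewrite -mulrA -exprD -mulSnr prednK ?fact_gt0 // exprMn -exprM.
    by rewrite mulfK // expf_neq0.
  have -> : shift2 t B = t ^+ (1 + B`! * B) by rewrite exprD.
  rewrite E.
  by rewrite rpredM ?rpredX.
- exact/fg/H/fg.
Qed.

(** * Definable sets and omitting types *)

(** The operation [env_cons] over any type: it also extends tuples of variable indices, and
    [vcons_comp] carries one use to the other. *)
Definition vcons T n (x : T) (e : 'I_n -> T) (i : 'I_n.+1) : T :=
  if unlift ord0 i is Some j then e j else x.

Lemma vcons0 T n (x : T) (e : 'I_n -> T) : vcons x e ord0 = x.
Proof. by rewrite /vcons unlift_none. Qed.

Lemma vconsS T n (x : T) (e : 'I_n -> T) i : vcons x e (lift ord0 i) = e i.
Proof. by rewrite /vcons liftK. Qed.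

Lemma vcons_comp T T' (h : T -> T') n (x : T) (e : 'I_n -> T) :
  h \o vcons x e = vcons (h x) (h \o e).
Proof. by apply/funext => i; rewrite /vcons /=; case: unlift. Qed.

Lemma vconsE (M : mac_structure) n (x : M) (e : 'I_n -> M) : env_cons x e = vcons x e.
Proof. by []. Qed.

Lemma pair_env_comp T T' (h : T -> T') (s t : T) :
  h \o pair_env s t = pair_env (h s) (h t).
Proof. by apply/funext => i; rewrite /pair_env /=; case: ifP. Qed.

Definition lift_renaming n m (r : 'I_n -> 'I_m) : 'I_n.+1 -> 'I_m.+1 :=
  vcons ord0 (lift ord0 \o r).

Fixpoint term_ren n m (r : 'I_n -> 'I_m) (u : term n) : term m :=
  match u with
  | Var i => Var (r i)
  | Zero => Zero m
  | One => One m
  | Add u v => Add (term_ren r u) (term_ren r v)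
  | Opp u => Opp (term_ren r u)
  | Mul u v => Mul (term_ren r u) (term_ren r v)
  end.

Fixpoint formula_ren n (f : formula n) : forall m, ('I_n -> 'I_m) -> formula m :=
  match f with
  | Eq _ u v => fun m r => Eq (term_ren r u) (term_ren r v)
  | InO _ u => fun m r => InO (term_ren r u)
  | InP _ k u => fun m r => InP k (term_ren r u)
  | Bot _ => fun m r => Bot m
  | Not _ f => fun m r => Not (formula_ren f r)
  | And _ f g => fun m r => And (formula_ren f r) (formula_ren g r)
  | Or _ f g => fun m r => Or (formula_ren f r) (formula_ren g r)
  | Imp _ f g => fun m r => Imp (formula_ren f r) (formula_ren g r)
  | Forall _ f => fun m r => Forall (formula_ren f (lift_renaming r))
  | Exists _ f => fun m r => Exists (formula_ren f (lift_renaming r))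
  end.

Lemma eval_ren (M : mac_structure) n m (r : 'I_n -> 'I_m) (e : 'I_m -> M) u :
  eval e (term_ren r u) = eval (e \o r) u.
Proof. by elim: u => //= [u -> v ->|u ->|u -> v ->]. Qed.

Lemma holds_ren (M : mac_structure) n (f : formula n) m (r : 'I_n -> 'I_m) (e : 'I_m -> M) :
  holds (formula_ren f r) e = holds f (e \o r).
Proof.
have cons_ren k l (q : 'I_k -> 'I_l) (d : 'I_l -> M) x :
    env_cons x d \o lift_renaming q = env_cons x (d \o q).
  rewrite !vconsE /lift_renaming vcons_comp vcons0; congr (vcons _ _).
  by apply/funext => i /=; rewrite vconsS.
elim: f m r e => {n} /=.
- by move=> n u v m r e; rewrite !eval_ren.
- by move=> n u m r e; rewrite !eval_ren.
- by move=> n k u m r e; rewrite !eval_ren.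
- by [].
- by move=> n f IH m r e; rewrite IH.
- by move=> n f IHf g IHg m r e; rewrite IHf IHg.
- by move=> n f IHf g IHg m r e; rewrite IHf IHg.
- by move=> n f IHf g IHg m r e; rewrite IHf IHg.
- by move=> n f IH m r e; apply: eq_forall => x; rewrite IH cons_ren.
- by move=> n f IH m r e; apply: eq_exists => x; rewrite IH cons_ren.
Qed.

(** * Enumeration of formulas *)

Section Coding.
Local Notation tree := (GenTree.tree nat).
Local Notation leaf := (@GenTree.Leaf nat).
Local Notation node := (@GenTree.Node nat).

Fixpoint term_code n (u : term n) : tree :=
  match u with
  | Var i => leaf (val i)
  | Zero => node 0 [::]
  | One => node 1 [::]
  | Add u v => node 2 [:: term_code u; term_code v]
  | Opp u => node 3 [:: term_code u]
  | Mul u v => node 4 [:: term_code u; term_code v]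
  end.

Fixpoint term_decode (c : tree) n : term n :=
  match c with
  | GenTree.Leaf i => if insub i is Some j then Var j else Zero n
  | GenTree.Node 0 [::] => Zero n
  | GenTree.Node 1 [::] => One n
  | GenTree.Node 2 [:: a; b] => Add (term_decode a n) (term_decode b n)
  | GenTree.Node 3 [:: a] => Opp (term_decode a n)
  | GenTree.Node 4 [:: a; b] => Mul (term_decode a n) (term_decode b n)
  | _ => Zero n
  end.

Lemma term_codeK n (u : term n) : term_decode (term_code u) n = u.
Proof. by elim: u => /= [i|||u -> v ->|u ->|u -> v ->] //; rewrite valK. Qed.

Fixpoint formula_code n (f : formula n) : tree :=
  match f with
  | Eq _ u v => node 0 [:: term_code u; term_code v]
  | InO _ u => node 1 [:: term_code u]
  | InP _ k u => node 2 [:: leaf (val k); term_code u]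
  | Bot _ => node 3 [::]
  | Not _ f => node 4 [:: formula_code f]
  | And _ f g => node 5 [:: formula_code f; formula_code g]
  | Or _ f g => node 6 [:: formula_code f; formula_code g]
  | Imp _ f g => node 7 [:: formula_code f; formula_code g]
  | Forall _ f => node 8 [:: formula_code f]
  | Exists _ f => node 9 [:: formula_code f]
  end.

(** The number of free variables is not stored in the code but passed down, growing under
    quantifiers. Ill-formed codes, like that of [Bot], fall to the default [Bot]. *)
Fixpoint formula_decode (c : tree) n : formula n :=
  match c with
  | GenTree.Node 0 [:: a; b] => Eq (term_decode a n) (term_decode b n)
  | GenTree.Node 1 [:: a] => InO (term_decode a n)
  | GenTree.Node 2 [:: GenTree.Leaf k; a] =>
      if (insub k : option {k | (1 < k)%N}) is Some k then InP k (term_decode a n) else Bot n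
  | GenTree.Node 4 [:: a] => Not (formula_decode a n)
  | GenTree.Node 5 [:: a; b] => And (formula_decode a n) (formula_decode b n)
  | GenTree.Node 6 [:: a; b] => Or (formula_decode a n) (formula_decode b n)
  | GenTree.Node 7 [:: a; b] => Imp (formula_decode a n) (formula_decode b n)
  | GenTree.Node 8 [:: a] => Forall (formula_decode a n.+1)
  | GenTree.Node 9 [:: a] => Exists (formula_decode a n.+1)
  | _ => Bot n
  end.

Lemma formula_codeK n (f : formula n) : formula_decode (formula_code f) n = f.
Proof.
elim: f => {n} /= [n u v|n u|n k u|n|n f ->|n f -> g ->|n f -> g ->|n f -> g ->|n f ->|n f ->];
  by rewrite ?term_codeK //; case: insubP => [j _ /val_inj -> //|/negP[]]; exact: (valP k).
Qed.

Definition formula_enum n (c : nat) : formula n :=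
  formula_decode (odflt (leaf 0) (unpickle c)) n.

Lemma formula_enum_surj n (f : formula n) : exists c, formula_enum n c = f.
Proof. by exists (pickle (formula_code f)); rewrite /formula_enum pickleK formula_codeK. Qed.

End Coding.

(** Serves both the universe of the omitting model and the value group of a valuation ring. *)
Lemma quotient_exists (T : choiceType) (R : T -> T -> Prop) :
  (forall x, R x x) -> (forall x y, R x y -> R y x) ->
  (forall x y z, R x y -> R y z -> R x z) ->
  exists (Q : Type) (cl : T -> Q) (rep : Q -> T),
    (forall q, cl (rep q) = q) /\ forall x y, cl x = cl y <-> R x y.
Proof.
move=> Rr Rs Rt; pose r x y := `[< R x y >].
have rr : reflexive r by move=> x; apply/asboolP.
have rs : symmetric r by move=> x y; apply/asboolP/asboolP; apply: Rs.
have rt : transitive r.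
  by move=> y x z /asboolP xy /asboolP yz; apply/asboolP; apply: Rt xy yz.
pose e := EquivRel r rr rs rt.
exists {eq_quot e}, \pi_{eq_quot e}, repr; split=> [q|x y]; first exact: reprK.
by split=> [/eqmodP /asboolP //|xy]; apply/eqmodP/asboolP.
Qed.

(** * Definable sets of sequences *)

Section Definable.
Variable N : mac_structure.
Implicit Types (S : set (nat -> N)) (e : nat -> N).

(** Semantic form of a condition on Henkin constants: the coordinate [e k] is the value of the k-th
    constant. *)
Definition definable S :=
  exists n (f : formula n), forall e, S e <-> holds f (e \o val).

Lemma renaming_bound n (p : 'I_n -> nat) :
  exists m (r : 'I_n -> 'I_m), p = val \o r.
Proof.
exists (\max_i p i).+1, (fun i => inord (p i)); apply/funext => i /=.
by rewrite inordK // ltnS leq_bigmax.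
Qed.

Lemma definable_holds n (f : formula n) (p : 'I_n -> nat) :
  definable [set e : nat -> N | holds f (e \o p)]%classic.
Proof.
have [m [r ->]] := renaming_bound p.
by exists m, (formula_ren f r) => e; rewrite holds_ren.
Qed.

Lemma definableI S T : definable S -> definable T -> definable (S `&` T)%classic.
Proof.
move=> [n [f fS]] [m [g gT]].
exists (n + m)%N, (And (formula_ren f (widen_ord (leq_addr m n)))
                       (formula_ren g (widen_ord (leq_addl n m)))) => e.
by rewrite /= !holds_ren; split=> -[/fS ? /gT ?].
Qed.

Lemma definableT : definable setT.
Proof. by exists 0%N, (Not (Bot 0)) => e; split=> // _ []. Qed.

Definition update e k x : nat -> N := fun j => if j == k then x else e j.

Lemma definable_project S k : definable S ->
  definable [set e : nat -> N | exists x, S (update e k x)]%classic.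
Proof.
move=> [n [f fS]].
pose r (i : 'I_n) := if val i == k then ord0 else lift ord0 i.
exists n, (Exists (formula_ren f r)) => e /=.
suff H x : S (update e k x) <-> holds (formula_ren f r) (env_cons x (e \o val)).
  by split=> -[x /H]; exists x.
rewrite fS holds_ren; suff -> : update e k x \o val = env_cons x (e \o val) \o r by [].
apply/funext => i; rewrite /update /r /=; case: ifP => _.
  by rewrite vconsE vcons0.
by rewrite vconsE vconsS.
Qed.

Lemma definable_projects S (ks : seq nat) : definable S ->
  definable [set e : nat -> N | exists e', (forall k, k \notin ks -> e' k = e k) /\ S e']%classic.
Proof.
move=> dS; elim: ks => [|k ks [n [f IH]]].
  case: dS => n [f fS]; exists n, f => e; rewrite -fS; split=> [[e' [ee' Se']]|Se].
    by have <- : e' = e by apply/funext => k; apply: ee'.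
  by exists e.
have [m [g gP]] := definable_project k (ex_intro _ n (ex_intro _ f IH)).
exists m, g => e; rewrite -gP; split=> /= [[e' [ee' Se']]|[x [e' [ee' Se']]]].
  exists (e' k), e'; split=> // l lks; rewrite /update; case: eqP => [-> //|/eqP lk].
  by apply: ee'; rewrite inE negb_or lk.
exists e'; split=> // l; rewrite inE negb_or => /andP[lk lks].
by rewrite ee' // /update (negPf lk).
Qed.

Lemma definable_support S : definable S ->
  exists n, forall e e', (forall k, (k < n)%N -> e k = e' k) -> S e -> S e'.
Proof.
move=> [n [f fS]]; exists n => e e' ee' /fS fe; apply/fS.
by have <- : e \o val = e' \o val :> ('I_n -> N) by apply/funext => i /=; apply: ee'.
Qed.

(* The coordinates of S are moved up by 2 to leave 0 and 1 free for s and t;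
   this also covers the case i = j. *)
Lemma definable_pair S i j : definable S ->
  exists f : formula 2, forall s t, holds f (pair_env s t) <-> exists e, [/\ S e, e i = s & e j = t].
Proof.
move=> dS; have [n suppS] := definable_support dS; have [k [f fS]] := dS.
pose eqf : formula 2 := Eq (Var ord0) (Var ord_max).
pose p (l : 'I_k) := (val l).+2.
have dT := definableI (definable_holds f p)
  (definableI (definable_holds eqf (pair_env i.+2 0%N)) (definable_holds eqf (pair_env j.+2 1%N))).
have {dT} [m [g gP]] := definable_projects (map succn (map succn (iota 0 (n + i.+1 + j.+1)))) dT.
exists (formula_ren g (fun l : 'I_m => if val l == 0%N then ord0 else ord_max)) => s t.
rewrite holds_ren.
pose d k := if k is l.+1 then t else s.
have -> : pair_env s t \o (fun l : 'I_m => if val l == 0%N then ord0 else ord_max) = d \o val.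
  by apply/funext => l /=; rewrite /pair_env; case: (val l).
rewrite -gP; split=> [[e' /= [de' [fe' [ei ej]]]]|[e [Se ei ej]]].
  exists (fun k => e' k.+2); split; first exact/fS.
    by rewrite (_ : e' i.+2 = e' 0%N) // de' //; apply/mapP => -[].
  rewrite (_ : e' j.+2 = e' 1%N) // de' //; apply/mapP => -[l /mapP[l' _ ->]] //.
(* The quantified coordinates are 2 up to L + 1; beyond them the sequence must agree with [d], so
   [e] is cut off at [L], past its support and past [i] and [j]. *)
pose L := (n + i.+1 + j.+1)%N.
exists (fun k => if k is l.+2 then (if (l < L)%N then e l else t) else d k); split=> /=.
  case=> [|[|l]] //=; rewrite !mem_map; try by move=> ? ? [].
  by rewrite mem_iota /= add0n -/L => /negPf ->.
split; last by split; rewrite /= (_ : (_ < L)%N = true) ?ei ?ej // /L; lia.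
suff /fS : S (fun l => if (l < L)%N then e l else t) by [].
apply: suppS Se => l ln /=.
by rewrite (_ : (_ < L)%N = true) // /L; lia.
Qed.

End Definable.

(** * Generic sequences and the omitting model *)

Section OmittingTypes.
Variables (N : mac_structure) (a : nat -> formula 2).
Hypothesis dense_a : forall (f : formula 2) (s t : N), holds f (pair_env s t) ->
  exists n s' t', holds f (pair_env s' t') /\ holds (a n) (pair_env (s' : N) t').

Let cond (S : set (nat -> N)) := definable S /\ exists e, S e.

(** Henkin witnesses are coordinates: one [j] has to work for all sequences in [S]. *)
Definition witnessed (S : set (nat -> N)) n (f : formula n) : Prop :=
  match f with
  | Exists n g => exists j, forall e, S e -> holds g (env_cons (e j) (e \o val))
  | _ => True
  end.

Definition decided (S : set (nat -> N)) n (f : formula n) : Prop :=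
  (forall e, S e -> ~ holds f (e \o val)) \/
  ((forall e, S e -> holds f (e \o val)) /\ witnessed S f).

Lemma witnessed_dense n (f : formula n) S : cond S ->
  (forall e, S e -> holds f (e \o val)) ->
  exists S', [/\ cond S', (S' `<=` S)%classic & witnessed S' f].
Proof.
case: f => /= {n} [n u v|n u|n k u|n|n f|n f g|n f g|n f g|n f|n g];
  try by move=> cS _; exists S; split=> //; exact: subset_refl.
move=> [dS [e0 Se0]] Sf; have [m suppS] := definable_support dS.
(* A coordinate beyond the support of [S] and the free variables of the formula can be reset to a
   witness. *)
pose j := (m + n)%N.
pose S' := (S `&` [set e : nat -> N | holds g (e \o vcons j val)])%classic.
have envE e : env_cons (e j) (e \o val) = e \o vcons j (val : 'I_n -> nat).
  by rewrite vcons_comp.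
exists S'; split; last 2 first.
- by move=> e [].
- by exists j => e [_]; rewrite envE.
split; first by apply: definableI => //; exact: definable_holds.
have [x gx] := Sf _ Se0; exists (update e0 j x); split.
  apply: suppS Se0 => k km; rewrite /update ifN //.
  by rewrite neq_ltn (leq_trans km) ?leq_addr.
rewrite /= vcons_comp /update eqxx.
have -> // : (fun i => if i == j then x else e0 i) \o val = e0 \o val :> ('I_n -> N).
apply/funext => i /=; rewrite ifN // neq_ltn.
by rewrite (leq_trans (ltn_ord i)) ?leq_addl.
Qed.

Lemma decided_dense n (f : formula n) S : cond S ->
  exists S', [/\ cond S', (S' `<=` S)%classic & decided S' f].
Proof.
move=> [dS neS].
have [[e [Se fe]]|nf] := pselect (exists e, S e /\ holds f (e \o val)).
  have [] := @witnessed_dense n f (S `&` [set e : nat -> N | holds f (e \o val)])%classic.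
  - by split; [apply: definableI => //; exact: definable_holds | exists e].
  - by move=> ? [].
  move=> S' [cS' S'S wS']; exists S'; split=> //; first by move=> ? /S'S [].
  by right; split=> // ? /S'S [].
by exists S; split=> //; left=> e Se fe; apply: nf; exists e.
Qed.

(** The projection of [S] to the coordinates [i] and [j] is defined by a formula, to which [dense_a]
    applies. *)
Lemma type_dense (i j : nat) S : cond S ->
  exists S' n, [/\ cond S', (S' `<=` S)%classic &
    forall e, S' e -> holds (a n) (e \o pair_env i j)].
Proof.
move=> [dS [e Se]]; have [f fP] := definable_pair i j dS.
have [|n [s [t [/fP [e' [Se' si tj]] st]]]] := @dense_a f (e i) (e j).
  by apply/fP; exists e.
exists (S `&` [set e : nat -> N | holds (a n) (e \o pair_env i j)])%classic, n; split.
- split; first by apply: definableI => //; exact: definable_holds.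
  by exists e'; split=> //=; rewrite pair_env_comp si tj.
- by move=> ? [].
- by move=> ? [].
Qed.

Lemma generic_sequence : exists U : nat -> set (nat -> N),
  [/\ forall k, cond (U k), forall k, (U k.+1 `<=` U k)%classic,
      forall n (f : formula n), exists k, decided (U k) f &
      forall i j, exists k n, forall e, U k e -> holds (a n) (e \o pair_env i j)].
Proof.
(* Each stage treats a formula and a pair of coordinates at once, the other component of the code
   being a dummy. Request [k] is met by [U k.+1]. *)
pose req (q : nat * nat * (nat * nat)) S :=
  decided S (formula_enum q.1.1 q.1.2) /\
  exists n, forall e, S e -> holds (a n) (e \o pair_env q.2.1 q.2.2).
have step (p : nat * set (nat -> N)) : exists S', cond p.2 ->
    [/\ cond S', (S' `<=` p.2)%classic & req (odflt ((0, 0), (0, 0))%N (unpickle p.1)) S'].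
  have [cS|] := pselect (cond p.2); last by move=> ncS; exists p.2.
  move: (odflt _ _) => [[n c] [i j]].
  have [S1 [k [cS1 S1S hS1]]] := type_dense i j cS.
  have [S2 [cS2 S2S1 hS2]] := decided_dense (formula_enum n c) cS1.
  exists S2; split=> //; first by move=> ? /S2S1 /S1S.
  by split=> //=; exists k => e /S2S1; apply: hS1.
have [next nextP] := choice step.
pose U := fix U k := if k is k.+1 then next (k, U k) else setT.
have cU k : cond (U k).
  elim: k => [|k IH] /=; last by have [] := nextP (k, U k) IH.
  by split; [exact: definableT | exists (fun _ => mac_zero N)].
exists U; split=> //.
- by move=> k /=; have [] := nextP (k, U k) (cU k).
- move=> n f; have [c <-] := formula_enum_surj f.
  exists (pickle ((n, c), (0, 0))%N).+1 => /=.
  by set k := pickle _; have [_ _] := nextP (k, U k) (cU k); rewrite /= pickleK => -[].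
- move=> i j; exists (pickle ((0, 0), (i, j))%N).+1 => /=.
  by set k := pickle _; have [_ _] := nextP (k, U k) (cU k); rewrite /= pickleK => -[].
Qed.

(* The sets containing some U k form an ultrafilter on the definable sets; the
   model is nat modulo almost sure equality of coordinates. *)
Theorem omitting_types : exists M : mac_structure,
  is_model (Th N) M /\ forall s t : M, exists n, holds (a n) (pair_env s t).
Proof.
have [U [cU Ud Udec Ua]] := generic_sequence.
pose D (P : set (nat -> N)) := exists k, (U k `<=` P)%classic.
have Umono k l : (k <= l)%N -> (U l `<=` U k)%classic.
  elim: l => [|l IH]; first by rewrite leqn0 => /eqP ->.
  rewrite leq_eqVlt => /orP[/eqP -> //|/IH kl]; exact: subset_trans (Ud l) kl.
have D2 (P Q R : set (nat -> N)) : (forall e, P e -> Q e -> R e) -> D P -> D Q -> D R.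
  move=> PQR [k kP] [l lQ]; exists (maxn k l) => e Ue; apply: PQR.
    by apply: kP; apply: Umono Ue; exact: leq_maxl.
  by apply: lQ; apply: Umono Ue; exact: leq_maxr.
have D1 (P Q : set (nat -> N)) : (forall e, P e -> Q e) -> D P -> D Q.
  by move=> PQ DP; apply: (D2 P P Q _ DP DP) => e /PQ.
have D3 (P Q R T : set (nat -> N)) :
    (forall e, P e -> Q e -> R e -> T e) -> D P -> D Q -> D R -> D T.
  move=> PQRT DP DQ DR; have DPQ := D2 _ _ (P `&` Q)%classic (fun _ => @conj _ _) DP DQ.
  by apply: (D2) DPQ DR => e [Pe Qe]; exact: PQRT.
have D0 (P : set (nat -> N)) : (forall e, P e) -> D P by move=> PT; exists 0%N.
have Dn (P : set (nat -> N)) : (forall e, ~ P e) -> ~ D P.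
  by move=> nP [k kP]; have [_ [e /kP /nP]] := cU k.
(* This makes [D] ultra. [decided] speaks of initial coordinates only, so other tuples are reached
   by renaming. *)
have Dholds n (f : formula n) (p : 'I_n -> nat) :
    D [set e : nat -> N | holds f (e \o p)]%classic \/ D [set e : nat -> N | ~ holds f (e \o p)]%classic.
  have [m [r pE]] := renaming_bound p.
  have [k] := Udec _ (formula_ren f r).
  case=> [H|[H _]]; [right | left]; exists k => e /H; by rewrite holds_ren pE.
have Dwit n (f : formula n.+1) (p : 'I_n -> nat) :
    D [set e : nat -> N | exists x, holds f (env_cons x (e \o p))]%classic ->
    exists j, D [set e : nat -> N | holds f (e \o vcons j p)]%classic.
  have [m [r ->]] := renaming_bound p.
  have [k] := Udec _ (formula_ren (Exists f) r).
  case=> [H DE|[_ [j jP]] _].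
    have DE' : D [set e : nat -> N | ~ exists x, holds f (env_cons x (e \o (val \o r)))]%classic.
      by exists k => e /H; rewrite holds_ren.
    by have := @D2 _ _ [set _ | False]%classic _ DE DE'; case/(_ _)/Dn => // e.
  exists j; exists k => e /jP.
  rewrite holds_ren /lift_renaming vcons_comp !vconsE vcons0 /=.
  rewrite vcons_comp (_ : vcons _ _ \o _ = e \o (val \o r)) //.
  by apply/funext => i /=; rewrite vconsS.
pose eqD i j := D [set e : nat -> N | e i = e j]%classic.
have [Q [cl [rep [repK clE]]]] : exists (Q : Type) (cl : nat -> Q) (rep : Q -> nat),
    (forall q, cl (rep q) = q) /\ forall x y, cl x = cl y <-> eqD x y.
  apply: quotient_exists => [i|i j|i j k]; first exact: D0.
    exact: D1.
  by apply: (D2) => e /= ->.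
have repE i : D [set e : nat -> N | e (rep (cl i)) = e i]%classic by apply/clE; rewrite repK.
have Dterm n (u : term n) (p : 'I_n -> nat) :
    exists k, D [set e : nat -> N | eval (e \o p) u = e k]%classic.
  (* The value of a term is a coordinate: it is the witness of the formula stating that something
     equals the term. *)
  have := @Dwit n (Eq (Var ord0) (term_ren (lift ord0) u)) p.
  have E k e : holds (Eq (Var ord0) (term_ren (lift ord0) u)) (e \o vcons k p) <->
      e k = eval (e \o p : 'I_n -> N) u.
    rewrite /= eval_ren vcons0 (_ : (e \o vcons k p) \o _ = e \o p) //.
    by apply/funext => i /=; rewrite vconsS.
  case=> [|k]; last by move=> H; exists k; apply: (D1) H => e /E.
  apply: D0 => e; exists (eval (e \o p) u) => /=.
  rewrite eval_ren vconsE vcons0; congr (eval _ _).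
  by apply/funext => i /=; rewrite vconsS.
pose p2 i j : 'I_2 -> nat := pair_env i j.
have [zero zeroP] := @Dterm 0 (Zero 0) (fun _ => 0%N).
have [one oneP] := @Dterm 0 (One 0) (fun _ => 0%N).
have addE (p : nat * nat) : exists k, D [set e : nat -> N | mac_add (e p.1) (e p.2) = e k]%classic.
  by have [k] := Dterm 2 (Add (Var ord0) (Var ord_max)) (p2 p.1 p.2); exists k.
have mulE (p : nat * nat) : exists k, D [set e : nat -> N | mac_mul (e p.1) (e p.2) = e k]%classic.
  by have [k] := Dterm 2 (Mul (Var ord0) (Var ord_max)) (p2 p.1 p.2); exists k.
have oppE i : exists k, D [set e : nat -> N | mac_opp (e i) = e k]%classic.
  by have [k] := Dterm 1 (Opp (Var ord0)) (fun _ => i); exists k.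
have [[add addP] [mul mulP]] := (choice addE, choice mulE).
have [opp oppP] := choice oppE.
pose M := @MacStructure Q (cl zero) (cl one)
  (fun x y => cl (add (rep x, rep y))) (fun x => cl (opp (rep x)))
  (fun x y => cl (mul (rep x, rep y)))
  [set x | D [set e : nat -> N | mac_O (e (rep x))]%classic]%classic
  (fun k => [set x | D [set e : nat -> N | mac_P k (e (rep x))]%classic]%classic).
have repD n (u : term n) (p : 'I_n -> nat) k :
    D [set e : nat -> N | eval (e \o p) u = e k]%classic ->
    D [set e : nat -> N | eval (e \o p) u = e (rep (cl k))]%classic.
  by move=> H; apply: (D2) H (repE k) => e /= -> ->.
have termP n (u : term n) (p : 'I_n -> nat) :
    exists k, eval (cl \o p : 'I_n -> M) u = cl k /\
      D [set e : nat -> N | eval (e \o p) u = e k]%classic.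
  elim: u => [i|||u [k [IHu Du]] v [l [IHv Dv]]|u [k [IHu Du]]|u [k [IHu Du]] v [l [IHv Dv]]].
  - by exists (p i); split=> //; apply: D0.
  - by exists zero.
  - by exists one.
  - exists (add (rep (cl k), rep (cl l))); split; first by rewrite /= IHu IHv.
    by apply: (D3) (repD _ _ _ _ Du) (repD _ _ _ _ Dv) (addP (rep (cl k), rep (cl l))) => e /= -> ->.
  - exists (opp (rep (cl k))); split; first by rewrite /= IHu.
    by apply: (D2) (repD _ _ _ _ Du) (oppP (rep (cl k))) => e /= ->.
  - exists (mul (rep (cl k), rep (cl l))); split; first by rewrite /= IHu IHv.
    by apply: (D3) (repD _ _ _ _ Du) (repD _ _ _ _ Dv) (mulP (rep (cl k), rep (cl l))) => e /= -> ->.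
have Dpred n (u : term n) (p : 'I_n -> nat) (P : set N) :
    D [set e : nat -> N | P (e (rep (eval (cl \o p : 'I_n -> M) u)))]%classic <->
    D [set e : nat -> N | P (eval (e \o p) u)]%classic.
  have [k [-> Du]] := termP n u p.
  have E : D [set e : nat -> N | e (rep (cl k)) = eval (e \o p) u]%classic.
    by apply: (D2) Du (repE k) => e /= -> ->.
  by split; apply: (D2) E => e /= ->.
(* The analogue of Los's theorem: [Dholds] handles negation and [Dwit] the quantifiers. *)
have truth n (f : formula n) (p : 'I_n -> nat) :
    holds f (cl \o p : 'I_n -> M) <-> D [set e : nat -> N | holds f (e \o p)]%classic.
  have consE (e : nat -> N) m (q : 'I_m -> nat) j : env_cons (e j) (e \o q) = e \o vcons j q.
    by rewrite vcons_comp.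
  have consM m (q : 'I_m -> nat) j : @env_cons M m (cl j) (cl \o q) = cl \o vcons j q.
    by rewrite vcons_comp.
  have DnP m (f' : formula m) q : D [set e : nat -> N | ~ holds f' (e \o q)]%classic <->
      ~ D [set e : nat -> N | holds f' (e \o q)]%classic.
    split=> [Dn1 Dn2|]; last by case: (Dholds m f' q).
    have : D (fun _ => False) by move: Dn1 Dn2; apply: (D2) => e nf hf; exact: nf.
    by move=> H; apply: (Dn _ _ H) => e.
  elim: f p => {n} [n u v|n u|n k u|n|n f IH|n f IHf g IHg|n f IHf g IHg|n f IHf g IHg|n f IH|n f IH] p.
  - have [k [/= -> Du]] := termP n u p; have [l [-> Dv]] := termP n v p.
    by rewrite clE; split; apply: (D3) Du Dv => e /= -> ->.
  - exact: Dpred.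
  - exact: Dpred.
  - by split=> // H; apply: (Dn _ _ H) => e.
  - by rewrite /= IH DnP.
  - rewrite /= IHf IHg; split=> [[]|H]; first by move=> Hf Hg; apply: (D2) Hf Hg.
    by split; apply: (D1) H => e [].
  - rewrite /= IHf IHg; split=> [[Hf|Hg]|H].
    - by apply: (D1) Hf => e; left.
    - by apply: (D1) Hg => e; right.
    have [|/DnP nf] := pselect (D [set e : nat -> N | holds f (e \o p)]%classic); first by left.
    by right; apply: (D2) nf H => e /= nf [].
  - rewrite /= IHf IHg; split=> [H|H Hf]; last by apply: (D2) H Hf => e; apply.
    have [/H|/DnP] := pselect (D [set e : nat -> N | holds f (e \o p)]%classic); apply: (D1) => e //=.
  - split=> /= [H|H x].
      (* If the universal formula fails almost surely, [Dwit] yields one coordinate that is a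
         counterexample almost surely. *)
      have [//|/(DnP _ (Forall f)) H'] := pselect (D [set e : nat -> N | holds (Forall f) (e \o p)]%classic).
      have [j] : exists j, D [set e : nat -> N | holds (Not f) (e \o vcons j p)]%classic.
        by apply: Dwit; apply: (D1) H' => e /= /existsNP.
      by move/DnP; case; apply/IH; rewrite -consM.
    by rewrite -(repK x) consM; apply/IH; apply: (D1) H => e /=; rewrite -consE.
  - split=> /= [[x]|/Dwit [j]].
      rewrite -(repK x) consM => /IH; apply: (D1) => e /=; rewrite -consE.
      by exists (e (rep x)).
    by move/IH; rewrite -consM; exists (cl j).
exists M; split=> [s Ns|s t].
  have := truth 0 s (fun _ => 0%N); rewrite /satisfies.
  have -> : cl \o (fun _ => 0%N) = @empty_env M by apply/funext => -[].
  move=> ->; apply: D0 => e /=.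
  by have -> : e \o (fun _ : 'I_0 => 0%N) = @empty_env N by apply/funext => -[].
have [k [n H]] := Ua (rep s) (rep t); exists n.
rewrite -[s]repK -[t]repK -pair_env_comp; apply/truth; exists k; exact: H.
Qed.

End OmittingTypes.

(** * Valued fields from models *)

Definition powers (F : fieldType) (k : power_index) : set F :=
  [set x | x != 0 /\ exists y : F, x = y ^+ val k]%classic.

(** The value group is the multiplicative group of F modulo the units of [O]. Concluding an equality
    of structures lets sentences transfer by rewriting. *)
Lemma valued_field_of_ring (F : fieldType) (O : set F) :
  O 1 -> (forall x y, O x -> O y -> O (x - y)) -> (forall x y, O x -> O y -> O (x * y)) ->
  (forall x, O x \/ O x^-1) -> (exists x, ~ O x) ->
  exists L : valued_field, Mac L = @MacStructure F 0 1 +%R -%R *%R O (@powers F).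
Proof.
move=> O1 OB OM Oinv [x0 x0O].
have O0 : O 0 by rewrite -(subrr 1); apply: OB.
have OD x y : O x -> O y -> O (x + y).
  by move=> Ox Oy; rewrite -[y]opprK -[- y]sub0r; apply: (OB) => //; apply: OB.
pose U := {x : F | x != 0}.
pose mulU (x y : U) : U := exist _ (val x * val y) (mulf_neq0 (valP x) (valP y)).
pose oneU : U := exist _ 1 (oner_neq0 F).
have invU_subproof (x : U) : (val x)^-1 != 0 by rewrite invr_eq0 (valP x).
pose invU (x : U) : U := exist _ (val x)^-1 (invU_subproof x).
(* Divisibility with quotient in [O]: it becomes the order on classes, and mutual divisibility is
   equality of classes. *)
pose dv (x y : U) := O (val y / val x).
have dv_refl x : dv x x by rewrite /dv divff ?(valP x).
have dv_trans y x z : dv x y -> dv y z -> dv x z.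
  rewrite /dv => xy yz; have -> : val z / val x = (val y / val x) * (val z / val y).
    by field; rewrite (valP x) (valP y).
  exact: OM.
have dv_mul x y z t : dv x y -> dv z t -> dv (mulU x z) (mulU y t).
  rewrite /dv /= => xy zt; have -> : val y * val t / (val x * val z) =
      (val y / val x) * (val t / val z) by field; rewrite (valP x) (valP z).
  exact: OM.
have dv_inv x y : dv x y -> dv (invU y) (invU x).
  by rewrite /dv /= invrK mulrC.
have dv_total x y : dv x y \/ dv y x.
  by have := Oinv (val y / val x); rewrite invf_div.
have [Q [cl [rep [repK clE]]]] : exists (Q : Type) (cl : U -> Q) (rep : Q -> U),
    (forall q, cl (rep q) = q) /\ forall x y, cl x = cl y <-> dv x y /\ dv y x.
  apply: quotient_exists => [x|x y|x y z] //; first by case.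
  by move=> [xy yx] [yz zy]; split; apply: (dv_trans y).
have repE x : dv (rep (cl x)) x /\ dv x (rep (cl x)) by apply/clE; rewrite repK.
pose Qc : choiceType := HB.pack Q (gen_eqMixin Q) (gen_choiceMixin Q).
pose addQ (q r : Qc) : Qc := cl (mulU (rep q) (rep r)).
pose oppQ (q : Qc) : Qc := cl (invU (rep q)).
pose zeroQ : Qc := cl oneU.
have addE x y : addQ (cl x) (cl y) = cl (mulU x y).
  by apply/clE; have [[? ?] [? ?]] := (repE x, repE y); split; apply: dv_mul.
have oppE x : oppQ (cl x) = cl (invU x).
  by apply/clE; have [? ?] := repE x; split; apply: dv_inv.
have ind (P : Qc -> Prop) : (forall x, P (cl x)) -> forall q, P q.
  by move=> Pcl q; rewrite -[q]repK.
have eqU x y : val x = val y -> cl x = cl y by move=> /val_inj ->.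
have addA : associative addQ.
  by elim/ind=> x; elim/ind=> y; elim/ind=> z; rewrite !addE; apply: eqU; rewrite /= mulrA.
have addC : commutative addQ.
  by elim/ind=> x; elim/ind=> y; rewrite !addE; apply: eqU; rewrite /= mulrC.
have add0 : left_id zeroQ addQ.
  by elim/ind=> x; rewrite !addE; apply: eqU; rewrite /= mul1r.
have addN : left_inverse zeroQ oppQ addQ.
  by elim/ind=> x; rewrite oppE addE; apply: eqU; rewrite /= mulVf // (valP x).
pose Qz : zmodType := HB.pack Q Qc (GRing.isZmodule.Build Qc addA addC add0 addN).
pose leQ (q r : Qz) := `[< dv (rep q) (rep r) >].
have leE x y : leQ (cl x) (cl y) = `[< dv x y >].
  have [[? ?] [? ?]] := (repE x, repE y); apply/asboolP/asboolP => H.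
    by apply: (dv_trans (rep (cl x))) => //; apply: (dv_trans (rep (cl y))).
  by apply: (dv_trans x) => //; apply: (dv_trans y).
have le_refl : reflexive leQ by elim/ind=> x; rewrite leE; apply/asboolP.
have le_anti : antisymmetric leQ.
  elim/ind=> x; elim/ind=> y; rewrite !leE => /andP[/asboolP xy /asboolP yx].
  exact/clE.
have le_trans : transitive leQ.
  elim/ind=> y; elim/ind=> x; elim/ind=> z; rewrite !leE => /asboolP xy /asboolP yz.
  by apply/asboolP; apply: dv_trans xy yz.
pose Qp : porderZmodType :=
  HB.pack Q Qz (Order.Le_isPOrder.Build ring_display Qz le_refl le_anti le_trans).
have le_clE x y : ((cl x : Qp) <= cl y) = `[< dv x y >] by exact: leE.
have add_clE x y : (cl x : Qp) + cl y = cl (mulU x y) by exact: addE.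
have le_total : total (<=%R : rel Qp).
  elim/ind=> x; elim/ind=> y; apply/orP.
  by have [] := dv_total x y; [left | right]; rewrite le_clE; apply/asboolP.
have le_add (x y z : Qp) : x <= y -> z + x <= z + y.
  elim/ind: x => x; elim/ind: y => y; elim/ind: z => z.
  rewrite !add_clE !le_clE => /asboolP xy.
  by apply/asboolP; apply: dv_mul.
pose G := OrderedGroup le_total le_add.
pose v (x : F) : option G := if (insub x : option U) is Some u then Some (cl u : G) else None.
have v0 : v 0 = None by rewrite /v insubF // eqxx.
have vU (u : U) : v (val u) = Some (cl u : G) by rewrite /v valK.
have vP x : x = 0 \/ exists u : U, x = val u.
  by have [->|x0'] := eqVneq x 0; [left | right; exists (exist _ x x0')].
have v_infty x : v x = None <-> x = 0.
  split=> [|->//]; have [//|[u ->]] := vP x; by rewrite vU.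
have vM x y : v (x * y) = vadd (v x) (v y).
  have [->|[u ->]] := vP x; first by rewrite mul0r v0.
  have [->|[w ->]] := vP y; first by rewrite mulr0 v0 vU.
  have -> : val u * val w = val (mulU u w) by [].
  by rewrite !vU /=; congr Some; rewrite [RHS]add_clE.
have vle_dv (u w : U) : vle (v (val u)) (v (val w)) = `[< dv u w >].
  by rewrite !vU /= le_clE.
have vle_div (u : U) x : vle (v (val u)) (v x) <-> O (x / val u).
  have [->|[w ->]] := vP x; first by rewrite v0 mul0r; case: (v _).
  by rewrite vle_dv; split=> /asboolP.
have vD x y : vle (vmin (v x) (v y)) (v (x + y)).
  have key a b : vle (v a) (v b) -> vle (v a) (v (a + b)).
    have [->|[u ->]] := vP a; first by rewrite add0r.
    move=> /vle_div ab; apply/vle_div; rewrite mulrDl; apply: OD => //.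
    by rewrite divff ?(valP u).
  rewrite /vmin; case: ifP => [/key //|/negbT xy]; rewrite addrC; apply: key.
  case: (v x) (v y) xy => [g|] [h|] //= /negPf gh.
  by have := le_total h g; rewrite gh orbF.
have v_surj g : exists x, v x = Some g.
  by exists (val (rep g)); rewrite vU; congr Some; exact: repK.
have v_O x : vle (Some 0) (v x) <-> O x.
  have -> : Some 0 = v (val oneU) by rewrite vU.
  by rewrite vle_div /= divr1.
have v_nontriv : exists x, vlt (v x) (Some 0).
  by exists x0; apply/negP => /v_O.
exists (ValuedField v_infty vM vD v_surj v_nontriv).
rewrite /Mac; congr MacStructure.
by apply/seteqP; split=> x /=; rewrite inE => /v_O.
Qed.

Fixpoint term_pow n (u : term n) (k : nat) : term n :=
  if k is k.+1 then Mul u (term_pow u k) else One n.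

Lemma eval_term_pow (L : valued_field) n (u : term n) k (e : 'I_n -> Mac L) :
  eval e (term_pow u k) = (eval e u : L) ^+ k.
Proof. by elim: k => [|k IH]; rewrite ?expr0 // exprS -IH. Qed.

Local Notation v0 := (Var ord0).
Local Notation v1 := (Var (lift ord0 ord0)).
Local Notation v2 := (Var (lift ord0 (lift ord0 ord0))).

(* Holds when t = 0 or s is not a nonzero infinitesimal, or when t divides s^k. *)
Definition arch_formula (k : nat) : formula 2 :=
  let s := Var (ord0 : 'I_2) in let t := Var (ord_max : 'I_2) in
  Or (Or (Eq s (Zero 2)) (Eq t (Zero 2)))
     (Or (Exists (And (InO v0) (Eq (Mul (term_ren (lift ord0) s) v0) (One 3))))
         (Exists (And (InO v0) (Eq (term_pow (term_ren (lift ord0) s) k)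
                                   (Mul (term_ren (lift ord0) t) v0))))).

Lemma holds_arch (L : valued_field) k (s t : L) :
  @holds (Mac L) 2 (arch_formula k) (pair_env s t) <->
  [\/ s = 0, t = 0, s^-1 \in valring L | s ^+ k / t \in valring L].
Proof.
have E z i : @env_cons (Mac L) _ z (pair_env s t) (lift ord0 i) = pair_env s t i.
  exact: vconsS.
have E0 z : @env_cons (Mac L) _ z (pair_env s t) ord0 = z by exact: vcons0.
have [s0|s0] := eqVneq s 0; first by split=> _; [constructor 1 | left; left].
have [t0|t0] := eqVneq t 0; first by split=> _; [constructor 2 | left; right].
split.
  case=> [[/= /eqP|/= /eqP]|[[z /= [Oz]]|[z /= [Oz]]]].
  - by rewrite (negPf s0).
  - by rewrite (negPf t0).
  - rewrite E0 in Oz; rewrite !E E0 /= => sz; constructor 3.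
    by rewrite -[s^-1]mulr1 -sz mulKf.
  - rewrite E0 in Oz; rewrite eval_term_pow /= !E E0 /= => stz; constructor 4.
    by rewrite stz /pair_env /= mulrAC divff // mul1r.
case=> [/eqP|/eqP|sO|stO]; rewrite ?(negPf s0) ?(negPf t0) //; right.
  by left; exists s^-1; split; rewrite /= ?E ?E0 //= mulfV.
right; exists (s ^+ k / t); split; rewrite /= ?eval_term_pow /= ?E ?E0 //=.
by rewrite /pair_env /= mulrCA mulfV // mulr1.
Qed.

(** A nonzero convex subgroup contains some h > 0, and every g >= 0 is below a multiple of h, hence
    in the subgroup. *)
Lemma arch_rank_one (L : valued_field) :
  (forall s t : L, exists k, @holds (Mac L) 2 (arch_formula k) (pair_env s t)) -> rank_one L.
Proof.
move=> arch; split.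
  have [x xO] := vf_nontrivial L; case E: (vval x) xO => [g|] // g0.
  by exists g; apply: contraNneq g0 => ->; rewrite /= lexx.
move=> H [[H0 HB] Hconv].
have [[h [Hh h0]]|nH] := pselect (exists h, h \in H /\ h != 0); last first.
  left; apply/seteqP; split=> x /=; last by move=> ->; exact/set_mem.
  by move=> Hx; apply: contrapT => /eqP x0; apply: nH; exists x; split=> //; exact/mem_set.
right; apply/seteqP; split=> // g _; apply/set_mem.
have HN x : x \in H -> - x \in H by move=> Hx; rewrite -sub0r; apply: HB.
have HD x y : x \in H -> y \in H -> x + y \in H.
  by move=> Hx Hy; rewrite -[y]opprK; apply: (HB) => //; exact: HN.
wlog hpos : h Hh h0 / 0 <= h => [W|].
  have /orP[|h_le0] := og_total 0 h; first exact: W.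
  apply: (W (- h)); rewrite ?oppr_eq0 //; first exact: HN.
  by have := og_add (- h) h_le0; rewrite addNr addr0.
wlog gpos : g / 0 <= g => [W|].
  have /orP[|g_le0] := og_total 0 g; first exact: W.
  rewrite -[g]opprK; apply: HN; apply: W.
  by have := og_add (- g) g_le0; rewrite addNr addr0.
have [s vs] := vval_surj h; have [t vt] := vval_surj g.
have s0 : s != 0 by apply/eqP => /vval_infty; rewrite vs.
have t0 : t != 0 by apply/eqP => /vval_infty; rewrite vt.
have vsX k : vval (s ^+ k) = Some (h *+ k).
  by elim: k => [|k IH]; rewrite ?expr0 ?vval1 ?mulr0n // exprS vvalM IH vs mulrS.
have Hk k : h *+ k \in H.
  by elim: k => [|k IH]; [rewrite mulr0n | rewrite mulrS; exact: HD].
have [k /holds_arch[/eqP|/eqP|sO|stO]] := arch s t.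
- by rewrite (negPf s0).
- by rewrite (negPf t0).
- have : vle (vval s) (Some 0) by rewrite -(vval1 L) vle_div // div1r.
  rewrite vs /= => h_le0; case/eqP: h0; apply: le_anti.
  by rewrite h_le0 hpos.
- apply: (Hconv 0 g (h *+ k)) => //.
  by move: stO; rewrite -vle_div // vt vsX.
Qed.

Lemma env_cons0 (M : mac_structure) n (x : M) (e : 'I_n -> M) : env_cons x e ord0 = x.
Proof. exact: vcons0. Qed.

Lemma env_consS (M : mac_structure) n (x : M) (e : 'I_n -> M) i :
  env_cons x e (lift ord0 i) = e i.
Proof. exact: vconsS. Qed.

Definition env_consE := (env_cons0, env_consS).

(** * Axioms of valued fields in a model of the theory *)

Section Model.
Variables (K : valued_field) (T : Type) (zero one : T) (add : T -> T -> T) (opp : T -> T)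
  (mul : T -> T -> T) (O : set T) (P : power_index -> set T).
Let M := MacStructure zero one add opp mul O P.
Hypothesis modelM : is_model (Th (Mac K)) M.

Lemma model_addA : associative add.
Proof.
have H : satisfies M (Forall (Forall (Forall (Eq (Add v2 (Add v1 v0)) (Add (Add v2 v1) v0))))).
  by apply: modelM => x y z /=; rewrite !env_consE; exact: addrA.
by move=> x y z; have /= := H x y z; rewrite !env_consE.
Qed.

Lemma model_addC : commutative add.
Proof.
have H : satisfies M (Forall (Forall (Eq (Add v1 v0) (Add v0 v1)))).
  by apply: modelM => x y /=; rewrite !env_consE; exact: addrC.
by move=> x y; have /= := H x y; rewrite !env_consE.
Qed.

Lemma model_add0 : left_id zero add.
Proof.
have H : satisfies M (Forall (Eq (Add (Zero _) v0) v0)).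
  by apply: modelM => x /=; rewrite !env_consE; exact: add0r.
by move=> x; have /= := H x; rewrite !env_consE.
Qed.

Lemma model_addN : left_inverse zero opp add.
Proof.
have H : satisfies M (Forall (Eq (Add (Opp v0) v0) (Zero _))).
  by apply: modelM => x /=; rewrite !env_consE; exact: addNr.
by move=> x; have /= := H x; rewrite !env_consE.
Qed.

Lemma model_mulA : associative mul.
Proof.
have H : satisfies M (Forall (Forall (Forall (Eq (Mul v2 (Mul v1 v0)) (Mul (Mul v2 v1) v0))))).
  by apply: modelM => x y z /=; rewrite !env_consE; exact: mulrA.
by move=> x y z; have /= := H x y z; rewrite !env_consE.
Qed.

Lemma model_mulC : commutative mul.
Proof.
have H : satisfies M (Forall (Forall (Eq (Mul v1 v0) (Mul v0 v1)))).
  by apply: modelM => x y /=; rewrite !env_consE; exact: mulrC.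
by move=> x y; have /= := H x y; rewrite !env_consE.
Qed.

Lemma model_mul1 : left_id one mul.
Proof.
have H : satisfies M (Forall (Eq (Mul (One _) v0) v0)).
  by apply: modelM => x /=; rewrite !env_consE; exact: mul1r.
by move=> x; have /= := H x; rewrite !env_consE.
Qed.

Lemma model_mulD : left_distributive mul add.
Proof.
have H : satisfies M (Forall (Forall (Forall
    (Eq (Mul (Add v2 v1) v0) (Add (Mul v2 v0) (Mul v1 v0)))))).
  by apply: modelM => x y z /=; rewrite !env_consE; exact: mulrDl.
by move=> x y z; have /= := H x y z; rewrite !env_consE.
Qed.

Lemma model_one_neq0 : one <> zero.
Proof.
have H : satisfies M (Not (Eq (One _) (Zero _))).
  by apply: modelM => /= /eqP; rewrite oner_eq0.
exact: H.
Qed.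

Lemma model_inverse x : x = zero \/ exists y, mul y x = one.
Proof.
have H : satisfies M (Forall (Or (Eq v0 (Zero _)) (Exists (Eq (Mul v0 v1) (One _))))).
  apply: modelM => y /=; rewrite !env_consE.
  have [->|y0] := eqVneq (y : K) 0; [by left | right].
  by exists (y : K)^-1; rewrite !env_consE; exact: mulVf.
have /= := H x; rewrite !env_consE => -[|[y]]; first by left.
by rewrite !env_consE; right; exists y.
Qed.

Lemma model_O1 : O one.
Proof.
have H : satisfies M (InO (One _)) by apply: modelM; exact: (rpred1 (valring K)).
exact: H.
Qed.

Lemma model_OB x y : O x -> O y -> O (add x (opp y)).
Proof.
have H : satisfies M (Forall (Forall (Imp (InO v1) (Imp (InO v0) (InO (Add v1 (Opp v0))))))).
  by apply: modelM => a b /=; rewrite !env_consE => Oa Ob; exact: (@rpredB _ (valring K)).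
by have /= := H x y; rewrite !env_consE.
Qed.

Lemma model_OM x y : O x -> O y -> O (mul x y).
Proof.
have H : satisfies M (Forall (Forall (Imp (InO v1) (Imp (InO v0) (InO (Mul v1 v0)))))).
  by apply: modelM => a b /=; rewrite !env_consE => Oa Ob; exact: (@rpredM _ (valring K)).
by have /= := H x y; rewrite !env_consE.
Qed.

Lemma model_O_inverse x : O x \/ exists y, O y /\ mul y x = one.
Proof.
have H : satisfies M (Forall (Or (InO v0) (Exists (And (InO v0) (Eq (Mul v0 v1) (One _)))))).
  apply: modelM => y /=; rewrite !env_consE.
  have [Oy|Vy] := @valring_inv_or K y; first by left.
  have [y0|y0] := eqVneq (y : K) 0; first by left; rewrite y0; exact: (rpred0 (valring K)).
  by right; exists (y : K)^-1; rewrite !env_consE; split=> //; exact: mulVf.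
have /= := H x; rewrite !env_consE => -[|[y]]; first by left.
by rewrite !env_consE; right; exists y.
Qed.

Lemma model_O_proper : exists x, ~ O x.
Proof.
have H : satisfies M (Exists (Not (InO v0))).
  apply: modelM; have [x xO] := vf_nontrivial K; exists x; rewrite /= !env_consE.
  exact/negP.
by have [x /=] := H; rewrite !env_consE; exists x.
Qed.

(** The theory fixes the power predicates. Powers are written with [iter] because [T] carries no
    ring structure yet. *)
Lemma model_P k x : P k x <->
  x <> zero /\ exists y, x = iter (val k) (mul y) one.
Proof.
have evalE (N : mac_structure) n (u : term n) j (e : 'I_n -> N) :
    eval e (term_pow u j) = iter j (mac_mul (eval e u)) (mac_one N).
  by elim: j => [|j IH] //=; rewrite IH.
pose R : formula 1 := And (Not (Eq v0 (Zero _))) (Exists (Eq v1 (term_pow v0 (val k)))).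
have H : satisfies M (Forall (And (Imp (InP k v0) R) (Imp R (InP k v0)))).
  apply: modelM => y /=; rewrite !env_consE; split.
    case=> y0 [z zE]; split; first exact/eqP.
    by exists z; rewrite eval_term_pow /= !env_consE.
  case=> y0 [z]; rewrite eval_term_pow /= !env_consE => zE; split; first exact/eqP.
  by exists z.
have /= := H x; rewrite !env_consE => -[PR RP]; split.
  by move=> /PR[x0 [y]]; rewrite evalE /= !env_consE => yE; split=> //; exists y.
move=> [x0 [y yE]]; apply: RP; split=> //; exists y.
by rewrite evalE /= !env_consE.
Qed.

Lemma valued_field_of_components : exists L : valued_field, Mac L = M.
Proof.
pose Tc : choiceType := HB.pack T (gen_eqMixin T) (gen_choiceMixin T).
pose Tz : zmodType := HB.pack T Tc
  (GRing.isZmodule.Build Tc model_addA model_addC model_add0 model_addN).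
have one0 : (one : Tz) != 0 by apply/eqP; exact: model_one_neq0.
pose Tr : comNzRingType := HB.pack T Tz
  (GRing.Zmodule_isComNzRing.Build Tz model_mulA model_mulC model_mul1 model_mulD one0).
(* The inverse is chosen to be 0 at 0, as the field interface requires. *)
have inverse (x : Tr) : exists y : Tr, (x = 0 -> y = 0) /\ (x != 0 -> y * x = 1).
  have [->|x0] := eqVneq x 0; first by exists 0.
  have [x0'|[y yx]] := model_inverse x; first by move: x0; rewrite x0' eqxx.
  by exists y; split=> // x0'; move: x0; rewrite x0' eqxx.
have [inv invP] := choice inverse.
have mulV x : x != 0 -> inv x * x = 1 by case: (invP x).
have inv0 : inv 0 = 0 by case: (invP 0) => ->.
pose F : fieldType := HB.pack T Tr (GRing.ComNzRing_isField.Build Tr mulV inv0).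
have O_inv (x : F) : O x \/ O x^-1.
  have [|[y [Oy yx]]] := model_O_inverse x; first by left.
  have yx' : (y : F) * x = 1 by [].
  right; suff -> : x^-1 = y by [].
  have x0 : x != 0 by apply: contra_eq_neq yx' => ->; rewrite mulr0 eq_sym oner_eq0.
  by rewrite -[LHS]mul1r -yx' mulfK.
have [L LE] := @valued_field_of_ring F O model_O1 model_OB model_OM O_inv model_O_proper.
exists L; rewrite LE; congr (@MacStructure T); apply/funext => k.
have powE (y : F) j : iter j (mul y) one = y ^+ j.
  by elim: j => [|j IH]; rewrite ?expr0 // exprS -IH.
apply/seteqP; split=> x; rewrite model_P.
  by move=> [/eqP x0 [y xy]]; split=> //; exists y; rewrite powE.
by move=> [x0 [y xy]]; split; [exact/eqP | exists y; rewrite xy powE].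
Qed.

End Model.

Lemma valued_field_of_model (K : valued_field) (M : mac_structure) :
  is_model (Th (Mac K)) M -> exists L : valued_field, Mac L = M.
Proof. by case: M => T z o a n m O P; exact: valued_field_of_components. Qed.

Theorem theorem3p15 (K : valued_field)
  (charK : [pchar K] =i pred0)
  (charKres : [pchar (residue_field K)] =i pred0)
  (qeK : admits_qe (Th (Mac K)))
  (prohensK : prohenselian_degree K 2) :
  exists L : valued_field,
    rank_one L /\ elementarily_equivalent (Mac L) (Mac K).
Proof.
have [|M [modelM archM]] := @omitting_types (Mac K) arch_formula.
  move=> f s t hf.
  have [[s0 sM t0]|trivial_st] :=
      pselect [/\ (s : K) != 0, (s : K) \in valideal K & (t : K) != 0].
    have [s' [t' [n [t'0 st' hf']]]] := comparable_solution charKres prohensK qeK s0 sM t0 hf.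
    exists n, s', t'; split=> //; apply/(@holds_arch K); exact: Or44.
  (* For the remaining pairs a disjunct that does not involve the exponent holds, so exponent 0
     serves. *)
  exists 0%N, s, t; split=> //; apply/(@holds_arch K).
  have [s0|s0] := eqVneq (s : K) 0; first exact: Or41.
  have [t0|t0] := eqVneq (t : K) 0; first exact: Or42.
  apply: Or43; apply: contrapT => /negP sO; apply: trivial_st; split=> //.
  by apply/validealP; right.
have [L LM] := valued_field_of_model modelM; rewrite -LM in modelM archM.
exists L; split; first exact: arch_rank_one archM.
(* If [s] fails in K, its negation belongs to Th(K) and so holds in L. *)
move=> s; split=> [Ls|Ks]; last exact: modelM.
by apply: contrapT => nKs; apply: (modelM (Not s)).
Qed.
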